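(* Let $q:[0,\pi]\to\mathbb{R}$ be a potential admitting an absolutely convergent Fourier cosine expansion $$q(x)=\frac{q_0}{2}+\sum_{k=1}^\infty q_k\cos(kx),\qquad q_k=\frac{2}{\pi}\int_0^\pi q(x)\cos(kx)\,dx\quad (k=0,1,2,\dots).$$ Let $\lambda_1<\lambda_2\le\cdots$ be the eigenvalues of $-u''+qu=\lambda u$ on $(0,\pi)$ with Dirichlet conditions $u(0)=u(\pi)=0$, and let $\mu_0<\mu_1\le\cdots$ be the eigenvalues of $-u''+qu=\mu u$ on $(0,\pi)$ with Neumann conditions $u'(0)=u'(\pi)=0$. Then for all $n\ge1$, $$\sum_{k=1}^n\left[\frac{\lambda_k+\mu_k}{2}-k^2-\frac1\pi\int_0^\pi q(x)\,dx\right]+\frac12\left[\mu_0-\frac1\pi\int_0^\pi q(x)\,dx\right]\le0,$$ and equality for any $n\ge1$ implies that $q$ is constant.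
   Context: The eigenvalue problems are understood in the usual weak sense (form domains $H^1_0(0,\pi)$ and $H^1(0,\pi)$ respectively). Eigenvalues are listed in increasing order and repeated according to multiplicity; Dirichlet eigenvalues are numbered from $1$ and Neumann eigenvalues from $0$. *)

(* Defs.v *)
From HB Require Import structures.
From mathcomp Require Import all_boot all_order all_algebra.
From mathcomp Require Import all_classical all_reals all_analysis.
Import Order.TTheory GRing.Theory Num.Theory.
Import numFieldNormedType.Exports.

Set Implicit Arguments.
Unset Strict Implicit.
Unset Printing Implicit Defensive.

Local Open Scope classical_set_scope.
Local Open Scope ring_scope.

(* Functions on [0, pi] are represented by functions R -> R; every definition
   below depends only on their values on [0, pi]. *)

Definition dom (R : realType) : set R := `[0, pi]%classic.
Arguments dom R : clear implicits.

Definition integral0pi (R : realType) (f : R -> R) : R :=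
  \int[@lebesgue_measure R]_(x in dom R) f x.

Definition L2 (R : realType) (g : R -> R) : Prop :=
  measurable_fun (dom R) g /\
  (@lebesgue_measure R).-integrable (dom R) (fun x => (g x ^+ 2)%:E).

(* u is the absolutely continuous representative of an element of H^1(0, pi)
   and g is (a version of) its weak derivative. *)
Definition weak_derivative (R : realType) (u g : R -> R) : Prop :=
  L2 g /\
  forall x, x \in dom R ->
    u x = u 0 + \int[@lebesgue_measure R]_(t in `[0, x]) g t.

(* In dimension one the elements of H^1 are the absolutely continuous functions
   with derivative in L^2.  Using the continuous representative gives boundary
   values their pointwise meaning and makes equality of elements of H^1
   equality at every point of [0, pi]. *)
Definition H1 (R : realType) : set (R -> R) :=
  [set u : R -> R | exists g, weak_derivative u g].
Arguments H1 R : clear implicits.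

Definition H10 (R : realType) : set (R -> R) :=
  [set u : R -> R | [/\ H1 R u, u 0 = 0 & u pi = 0]].
Arguments H10 R : clear implicits.

(* The weak solutions in V (the zero function included) of
   - u'' + q u = t u.  The weak derivatives u', v' of u, v in V exist and are
   unique almost everywhere. *)
Definition weak_eigenspace (R : realType) (q : R -> R) (V : set (R -> R)) (t : R) :
    set (R -> R) :=
  [set u : R -> R | V u /\
    forall v u' v' : R -> R,
      V v -> weak_derivative u u' -> weak_derivative v v' ->
      integral0pi (fun x => u' x * v' x) +
      integral0pi (fun x => q x * u x * v x) =
      t * integral0pi (fun x => u x * v x)].

Definition has_dim (R : realType) (E : set (R -> R)) (m : nat) : Prop :=
  exists e : 'I_m -> R -> R,
    [/\ forall i, E (e i),
        forall c : 'I_m -> R,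
          (forall x, x \in dom R -> \sum_(i < m) c i * e i x = 0) ->
          forall i, c i = 0
      & forall u, E u -> exists c : 'I_m -> R,
          forall x, x \in dom R -> u x = \sum_(i < m) c i * e i x].

(* nu 0 <= nu 1 <= nu 2 <= ... lists exactly the eigenvalues with form domain V,
   each one as many times as the dimension of its eigenspace.  A real t that is
   not an eigenvalue has multiplicity 0 and so does not occur. *)
Definition eigenvalue_sequence (R : realType) (q : R -> R) (V : set (R -> R))
    (nu : nat -> R) : Prop :=
  (forall i j : nat, (i <= j)%N -> nu i <= nu j) /\
  (forall t : R, exists2 m : nat,
     has_dim (weak_eigenspace q V t) m & ([set k | nu k = t] #= `I_m)%card).

(* Dirichlet eigenvalues are numbered from 1: the value lambda 0 is unused. *)
Definition dirichlet_eigenvalues (R : realType) (q : R -> R)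
    (lambda : nat -> R) : Prop :=
  eigenvalue_sequence q (H10 R) (fun k => lambda k.+1).

Definition neumann_eigenvalues (R : realType) (q : R -> R)
    (mu : nat -> R) : Prop :=
  eigenvalue_sequence q (H1 R) mu.

Definition cos_coef (R : realType) (q : R -> R) (k : nat) : R :=
  2 / pi * integral0pi (fun x => q x * cos (k%:R * x)).

Definition abs_cvg_cosine_expansion (R : realType) (q : R -> R) : Prop :=
  cvgn (series (fun k => `|cos_coef q k|)) /\
  forall x, x \in dom R ->
    (fun N : nat => cos_coef q 0 / 2 +
       \sum_(1 <= k < N) cos_coef q k * cos (k%:R * x)) @ \oo --> q x.

Definition mean (R : realType) (q : R -> R) : R := pi^-1 * integral0pi q.

(* Main.v *)
Require Import Defs.
From HB Require Import structures.
From mathcomp Require Import all_boot all_order all_algebra.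
From mathcomp Require Import all_classical all_reals all_analysis.
From mathcomp Require Import measurable_realfun zify ring lra.
Import Order.TTheory GRing.Theory Num.Theory.
Import numFieldNormedType.Exports.

(** By the variational principle, the sum of the first eigenvalues is at most
    the trace of the quadratic form over any orthonormal family of as many trial
    functions. The trial functions are the eigenfunctions of the free operator:
    sin (k x), 1 <= k <= n, for the Dirichlet problem and cos (k x),
    0 <= k <= n, for the Neumann problem. Since 2 sin^2 (k x) = 1 - cos (2 k x)
    and 2 cos^2 (k x) = 1 + cos (2 k x), the coefficients q_(2 k) enter the two
    traces with opposite signs and cancel in the average, which leaves the
    stated inequality.

    If equality holds, the cosines up to frequency n minimise the trace.
    Rotating one of them, cos (i x), towards cos (p x) with p > n cannot
    decrease the trace, so that the off-diagonal entry between the two is zero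
    ([trace_equality_decouples]). For i = 0 this entry is a multiple of q_p,
    hence q_p = 0 for p > n. For i = n and p = n + k it is
    (q_k + q_(2 n + k)) / 2, hence q_k = 0 for all k >= 1 and q is constant.

    The variational principle has to be derived from the mere description of a
    list of eigenvalues with their multiplicities. In the cosine or sine basis
    the operator is an infinite matrix, D + B, with D diagonal and growing
    quadratically and B bounded on summable sequences because the Fourier
    coefficients of q are summable. Its finite truncations have orthonormal
    eigenvectors that satisfy Ky Fan's inequality ([trace_inequality]); their
    coefficients decay at a rate independent of the size of the truncation
    ([galerkin_bounds]), so that they converge, along an ultrafilter, to
    eigenvectors of the infinite matrix with the same inequality
    ([variational_eigenvectors]). The corresponding trigonometric series are
    continuously differentiable weak eigenfunctions
    ([coef_series_eigenfunction]). They are independent, hence a given value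
    occurs among their eigenvalues at most as often as the dimension of its
    eigenspace, and the given list lies below theirs
    ([eigenvalue_le_of_eigenfunctions]). *)

Set Implicit Arguments.
Unset Strict Implicit.
Unset Printing Implicit Defensive.

Local Open Scope classical_set_scope.
Local Open Scope ring_scope.

(** * Ky Fan's trace inequality for a symmetric matrix *)

(** The first-order condition at a minimum, for quadratic perturbations. *)
Lemma linear_coef_eq0 (R : realFieldType) (a b : R) :
  (forall s, 0 <= 2 * s * a + s ^+ 2 * b) -> a = 0.
Proof.
move=> h; apply/eqP/negPn/negP => a0.
have c0 : 0 < 1 + `|b| by have := normr_ge0 b; lra.
(* The vertex is at - a / b; the denominator 1 + |b| also serves b <= 0. *)
have := h (- a / (1 + `|b|)); set c := 1 + `|b| in c0 *.
have -> : 2 * (- a / c) * a + (- a / c) ^+ 2 * b = a ^+ 2 / c * (b / c - 2).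
  by field; rewrite gt_eqF.
rewrite pmulr_rge0; last by rewrite divr_gt0// exprn_even_gt0.
rewrite subr_ge0 ler_pdivlMr// => h1.
have := ler_norm b; rewrite /c in c0 h1; have := normr_ge0 b; lra.
Qed.

Lemma cvg_sumr (R : realType) (T : Type) (F : set_system T) (I : Type)
    (r : seq I) (P : pred I) (f : I -> T -> R) (a : I -> R) {FF : Filter F} :
  (forall i, P i -> f i t @[t --> F] --> a i) ->
  \sum_(i <- r | P i) f i t @[t --> F] --> \sum_(i <- r | P i) a i.
Proof. by apply: cvg_big; exact: add_continuous. Qed.

Definition dotv (R : realType) (N : nat) (x y : 'rV[R]_N) : R :=
  \sum_(j < N) x 0 j * y 0 j.

Section Dotv.
Context {R : realType} {N : nat}.
Implicit Types (x y z : 'rV[R]_N) (A : 'M[R]_N).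

Lemma dotvC x y : dotv x y = dotv y x.
Proof. by apply: eq_bigr => j _; rewrite mulrC. Qed.

Lemma dotvDl x y z : dotv (x + y) z = dotv x z + dotv y z.
Proof. by rewrite -big_split; apply: eq_bigr => j _; rewrite mxE mulrDl. Qed.

Lemma dotvZl a x z : dotv (a *: x) z = a * dotv x z.
Proof. by rewrite mulr_sumr; apply: eq_bigr => j _; rewrite mxE mulrA. Qed.

Lemma dotvBl x y z : dotv (x - y) z = dotv x z - dotv y z.
Proof. by rewrite dotvDl -scaleN1r dotvZl mulN1r. Qed.

Lemma dotv0l z : dotv 0 z = 0.
Proof. by rewrite -(scale0r 0) dotvZl mul0r. Qed.

Lemma dotv_suml (I : Type) (r : seq I) (P : pred I) (F : I -> 'rV[R]_N) z :
  dotv (\sum_(i <- r | P i) F i) z = \sum_(i <- r | P i) dotv (F i) z.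
Proof. by elim/big_ind2: _ => [|x1 x2 y1 y2 <- <-|//]; rewrite ?dotv0l// dotvDl. Qed.

Lemma dotvDr x y z : dotv z (x + y) = dotv z x + dotv z y.
Proof. by rewrite dotvC dotvDl !(dotvC z). Qed.

Lemma dotvZr a x z : dotv z (a *: x) = a * dotv z x.
Proof. by rewrite dotvC dotvZl (dotvC z). Qed.

Lemma dotvBr x y z : dotv z (x - y) = dotv z x - dotv z y.
Proof. by rewrite dotvC dotvBl !(dotvC z). Qed.

Lemma dotv_sumr (I : Type) (r : seq I) (P : pred I) (F : I -> 'rV[R]_N) z :
  dotv z (\sum_(i <- r | P i) F i) = \sum_(i <- r | P i) dotv z (F i).
Proof. by rewrite dotvC dotv_suml; apply: eq_bigr => i _; rewrite dotvC. Qed.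

Lemma dotvv_ge0 x : 0 <= dotv x x.
Proof. by apply: sumr_ge0 => j _; rewrite -expr2 sqr_ge0. Qed.

Lemma dotvv_eq0 x : dotv x x = 0 -> x = 0.
Proof.
move/eqP; rewrite psumr_eq0 => [/allP h|j _]; last by rewrite -expr2 sqr_ge0.
apply/rowP => j; have := h j (mem_index_enum _).
by rewrite mulf_eq0 orbb mxE => /eqP.
Qed.

Lemma dotv_mulmx A x y : dotv (x *m A) y = \sum_(j < N) \sum_(l < N) x 0 j * A j l * y 0 l.
Proof.
rewrite exchange_big; apply: eq_bigr => l _.
by rewrite mxE mulr_suml.
Qed.

Lemma dotv_sym A x y : A^T = A -> dotv (x *m A) y = dotv (y *m A) x.
Proof.
move=> As; rewrite !dotv_mulmx exchange_big; apply: eq_bigr => j _.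
by apply: eq_bigr => l _; rewrite -{1}As mxE; ring.
Qed.

Lemma continuous_dotv_mulmx A : continuous (fun x => dotv (x *m A) x).
Proof.
move=> x.
rewrite (_ : (fun x => _) =
  fun x => \sum_(j < N) \sum_(l < N) x 0 j * A j l * x 0 l); last first.
  by apply/funext => y; rewrite dotv_mulmx.
apply: (@cvg_sumr _ _ (nbhs x) _ _ _ _ _ (nbhs_filter x)) => j _.
apply: (@cvg_sumr _ _ (nbhs x) _ _ _ _ _ (nbhs_filter x)) => l _.
apply: cvgM; last exact: coord_continuous.
by apply: cvgM; [exact: coord_continuous|exact: cvg_cst].
Qed.

End Dotv.

Section SymmetricMinimisation.
Context {R : realType} {N : nat} (A : 'M[R]_N).
Hypothesis symA : A^T = A.
Local Notation form x y := (dotv (x *m A) y).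

Lemma exists_unit_orthogonal (k : nat) (v : nat -> 'rV[R]_N) : (k < N)%N ->
  exists2 x, dotv x x = 1 & forall i, (i < k)%N -> dotv x (v i) = 0.
Proof.
move=> kN; pose M := (\matrix_(i < k) v i)^T.
have M0 : kermx M != 0.
  rewrite -mxrank_eq0 mxrank_ker -lt0n subn_gt0.
  by rewrite (leq_ltn_trans (rank_leq_col M)).
have yv i : (i < k)%N -> dotv (nz_row (kermx M)) (v i) = 0.
  move=> ik; have /sub_kermxP/rowP/(_ (Ordinal ik)) := nz_row_sub (kermx M).
  by rewrite !mxE => <-; apply: eq_bigr => j _; rewrite !mxE.
move: M0 yv; rewrite -nz_row_eq0; set y := nz_row _ => y0 yv.
have yy : 0 < dotv y y.
  rewrite lt_neqAle dotvv_ge0 andbT eq_sym.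
  by apply: contra_neq y0; exact: dotvv_eq0.
exists ((Num.sqrt (dotv y y))^-1 *: y) => [|i ik]; last by rewrite dotvZl yv// mulr0.
rewrite dotvZl dotvZr mulrA -invfM -expr2 sqr_sqrtr ?dotvv_ge0//.
by rewrite mulVf// gt_eqF.
Qed.

(** Compactness of the unit sphere; by homogeneity the minimum over unit
    vectors becomes an inequality between quadratic forms. *)
Lemma exists_form_minimiser (k : nat) (v : nat -> 'rV[R]_N) : (k < N)%N ->
  exists x, [/\ dotv x x = 1, forall i, (i < k)%N -> dotv x (v i) = 0 &
    forall y, (forall i, (i < k)%N -> dotv y (v i) = 0) ->
      form x x * dotv y y <= form y y].
Proof.
move=> kN; pose S := [set x | dotv x x = 1] `&`
  \bigcap_(i in [set i : nat | (i < k)%N]) [set x : 'rV[R]_N | dotv x (v i) = 0].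
have S0 : S !=set0.
  by have [x x1 xv] := exists_unit_orthogonal v kN; exists x; split.
have cS : closed S.
  apply: closedI.
    refine (@preimage_closed ('rV[R]_N : topologicalType) (R : topologicalType)
      (fun x : 'rV[R]_N => dotv x x) [set x | x = 1] _ (@closed_eq _ _)).
    move=> x _; have := @continuous_dotv_mulmx R N 1%:M x.
    by under [X in continuous_at _ X]eq_fun do rewrite mulmx1.
  apply: closed_bigI => i _.
  refine (@preimage_closed ('rV[R]_N : topologicalType) (R : topologicalType)
    (fun x : 'rV[R]_N => dotv x (v i)) [set x | x = 0] _ (@closed_eq _ _)).
  move=> x _; apply: (@cvg_sumr _ _ (nbhs x) _ _ _ _ _ (nbhs_filter x)) => j _.
  by apply: cvgM; [exact: coord_continuous|exact: cvg_cst].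
have bS : bounded_set S.
  exists 1; split => [|r r1 x [/= xx _]]; first exact: num_real.
  apply: le_trans (ltW r1); rewrite [leLHS]/Num.norm /= mx_normrE.
  apply: bigmax_le => // -[i j] _ /=; rewrite (ord1 i).
  rewrite -(@ler_pXn2r _ 2) ?nnegrE// expr1n real_normK ?num_real// -xx.
  rewrite /dotv (bigD1 j)//= -expr2 lerDl.
  by apply: sumr_ge0 => l _; rewrite -expr2 sqr_ge0.
have [x /set_mem[/= x1 xv] xmin] := @EVT_min_rV R N (fun x => form x x) S S0
  (bounded_closed_compact bS cS)
  (continuous_subspaceT (@continuous_dotv_mulmx R N A)).
exists x; split => // y yv.
have [->|y0] := eqVneq y 0; first by rewrite mul0mx !dotv0l mulr0.
have yy : 0 < dotv y y.
  rewrite lt_neqAle dotvv_ge0 andbT eq_sym.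
  by apply: contra_neq y0; exact: dotvv_eq0.
have := xmin ((Num.sqrt (dotv y y))^-1 *: y).
rewrite -scalemxAl !dotvZl !dotvZr !mulrA -!invfM -!expr2 sqr_sqrtr ?dotvv_ge0//.
rewrite mulrC ler_pdivlMr//; apply; apply/mem_set; split => /=.
    rewrite !dotvZl !dotvZr !mulrA -!invfM -!expr2 sqr_sqrtr ?dotvv_ge0//.
  by rewrite mulVf// gt_eqF.
by move=> i ik /=; rewrite dotvZl yv// mulr0.
Qed.

(** The eigenvectors are found one at a time, each minimising the form on the
    orthogonal complement of the previous ones; the last clause records this
    minimality, which is what the trace inequality rests on. *)
Lemma min_eigenvectors (m : nat) : (m <= N)%N ->
  exists (alpha : nat -> R) (v : nat -> 'rV[R]_N),
  [/\ forall i j, (i <= j < m)%N -> alpha i <= alpha j,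
      forall i j, (i < m)%N -> (j < m)%N -> dotv (v i) (v j) = (i == j)%:R,
      forall i, (i < m)%N -> v i *m A = alpha i *: v i &
      forall y, (forall i, (i < m)%N -> dotv y (v i) = 0) ->
        forall i, (i < m)%N -> alpha i * dotv y y <= form y y].
Proof.
elim: m => [_|k IH kN].
  by exists (fun=> 0), (fun=> 0); split=> // i j; rewrite ltn0 andbF.
have [alpha [v [als vo va vmin]]] := IH (ltnW kN).
have [x [x1 xv xmin]] := exists_form_minimiser v kN.
set t := form x x in xmin.
have altt i : (i < k)%N -> alpha i <= t.
  by move=> ik; have := vmin x xv i ik; rewrite x1 mulr1.
(* First-order condition at the minimiser [x], in the directions orthogonal
   to the earlier eigenvectors. *)
have xA y : (forall i, (i < k)%N -> dotv y (v i) = 0) ->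
    form x y - t * dotv x y = 0.
  move=> yv; apply: (@linear_coef_eq0 _ _ (form y y - t * dotv y y)) => s.
  have /= : t * dotv (x + s *: y) (x + s *: y) <= form (x + s *: y) (x + s *: y).
    by apply: xmin => i ik; rewrite dotvDl dotvZl xv// yv// mulr0 addr0.
  rewrite mulmxDl -scalemxAl !dotvDl !dotvDr !dotvZl !dotvZr (dotv_sym y x symA).
  rewrite (dotvC y x) x1 -/t -subr_ge0 => h; apply: le_trans h _.
  rewrite le_eqVlt; apply/orP; left; apply/eqP; ring.
have xAv i : (i < k)%N -> form x (v i) = 0.
  by move=> ik; rewrite dotv_sym// va// dotvZl dotvC xv// mulr0.
have xAt : x *m A = t *: x.
  apply/eqP; rewrite -subr_eq0; apply/eqP; apply: dotvv_eq0.
  have zv i : (i < k)%N -> dotv (x *m A - t *: x) (v i) = 0.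
    by move=> ik; rewrite dotvBl xAv// dotvZl xv// mulr0 subr0.
  by rewrite {1}dotvBl dotvZl xA.
exists (fun i => if i == k then t else alpha i),
  (fun i => if i == k then x else v i); split.
- move=> i j /andP[ij]; rewrite ltnS leq_eqVlt => /predU1P[jk|jk].
    rewrite jk eqxx; case: eqVneq => // ik; apply: altt.
    by rewrite ltn_neqAle ik -jk.
  by rewrite !ltn_eqF ?(leq_ltn_trans ij)//; apply: als; rewrite ij.
- move=> i j; rewrite !ltnS (leq_eqVlt i) (leq_eqVlt j) => /predU1P[->|ik] /predU1P[->|jk].
  + by rewrite !eqxx.
  + by rewrite eqxx (ltn_eqF jk) gtn_eqF// xv.
  + by rewrite eqxx (ltn_eqF ik) dotvC xv.
  + by rewrite (ltn_eqF ik) (ltn_eqF jk) vo.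
- move=> i; rewrite ltnS leq_eqVlt => /predU1P[->|ik]; first by rewrite eqxx.
  by rewrite ltn_eqF// va.
- move=> y yv.
  have yv' i : (i < k)%N -> dotv y (v i) = 0.
    by move=> ik; have := yv i (ltnW ik); rewrite ltn_eqF.
  move=> i; rewrite ltnS leq_eqVlt => /predU1P[->|ik].
    by rewrite eqxx; exact: xmin.
  by rewrite ltn_eqF//; exact: vmin.
Qed.

(** Ky Fan's inequality. Decompose each [phi i] along the [v j]: the trace is
    at least a combination of the [alpha j] with total mass [m], in which
    [alpha j] has weight at most 1 by Bessel and the mass left over is charged
    to the largest eigenvalue. Such a combination is smallest when every weight
    equals 1. *)
Lemma trace_inequality (m : nat) (alpha : nat -> R) (v phi : nat -> 'rV[R]_N) :
  (forall i j, (i <= j < m)%N -> alpha i <= alpha j) ->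
  (forall i j, (i < m)%N -> (j < m)%N -> dotv (v i) (v j) = (i == j)%:R) ->
  (forall i, (i < m)%N -> v i *m A = alpha i *: v i) ->
  (forall y, (forall i, (i < m)%N -> dotv y (v i) = 0) ->
     forall i, (i < m)%N -> alpha i * dotv y y <= form y y) ->
  (forall i j, (i < m)%N -> (j < m)%N -> dotv (phi i) (phi j) = (i == j)%:R) ->
  \sum_(i < m) alpha i <= \sum_(i < m) form (phi i) (phi i).
Proof.
case: m => [|m] als vo va vmin phio; first by rewrite !big_ord0.
pose c (i j : 'I_m.+1) := dotv (phi i) (v j).
have parts (i : 'I_m.+1) : alpha m + \sum_(j < m.+1) (alpha j - alpha m) * c i j ^+ 2
    <= form (phi i) (phi i).
  pose p := \sum_(j < m.+1) c i j *: v j.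
  pose r := phi i - p.
  have pE (w : 'I_m.+1) : dotv p (v w) = c i w.
    rewrite dotv_suml (bigD1 w)//= dotvZl vo// eqxx mulr1 big1 ?addr0// => j jw.
    by rewrite dotvZl vo// (_ : (j : nat) == w = false) ?mulr0//; exact/negbTE.
  have rv (w : 'I_m.+1) : dotv r (v w) = 0 by rewrite dotvBl pE /c subrr.
  have pA : p *m A = \sum_(j < m.+1) (alpha j * c i j) *: v j.
    rewrite mulmx_suml; apply: eq_bigr => j _.
    by rewrite -scalemxAl va// scalerA mulrC.
  have pAr : form p r = 0.
    rewrite pA dotv_suml big1// => j _.
    by rewrite dotvZl dotvC rv mulr0.
  have pr : dotv p r = 0.
    by rewrite dotv_suml big1// => j _; rewrite dotvZl dotvC rv mulr0.
  have pp : dotv p p = \sum_(j < m.+1) c i j ^+ 2.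
    rewrite {2}/p dotv_sumr; apply: eq_bigr => j _.
    by rewrite dotvZr pE expr2.
  have pAp : form p p = \sum_(j < m.+1) alpha j * c i j ^+ 2.
    rewrite pA dotv_suml; apply: eq_bigr => j _.
    by rewrite dotvZl dotvC pE expr2 mulrA.
  have phiE : phi i = p + r by rewrite /r addrC subrK.
  clearbody p r.
  have r1 : dotv r r = 1 - \sum_(j < m.+1) c i j ^+ 2.
    have := phio i i (ltn_ord i) (ltn_ord i); rewrite eqxx phiE.
    rewrite dotvDl !dotvDr (dotvC r p) pr pp /= mulr1n; lra.
  rewrite phiE mulmxDl dotvDl !dotvDr (dotv_sym r p symA) pAr pAp.
  have := vmin r (fun w wm => rv (Ordinal wm)) m (ltnSn m).
  have -> : \sum_(j < m.+1) (alpha j - alpha m) * c i j ^+ 2 =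
      \sum_(j < m.+1) alpha j * c i j ^+ 2 - alpha m * \sum_(j < m.+1) c i j ^+ 2.
    by rewrite mulr_sumr -sumrB; apply: eq_bigr => j _; rewrite mulrBl.
  rewrite r1; lra.
have bessel (j : 'I_m.+1) : \sum_(i < m.+1) c i j ^+ 2 <= 1.
  pose p := \sum_(i < m.+1) c i j *: phi i.
  have pp : dotv p p = \sum_(i < m.+1) c i j ^+ 2.
    rewrite {1}/p dotv_suml; apply: eq_bigr => i _.
    rewrite dotvZl dotv_sumr (bigD1 i)//= dotvZr phio// eqxx big1 ?addr0 ?mulr1//.
    move=> w wi; rewrite dotvZr phio// (_ : (i : nat) == w = false) ?mulr0//.
    by rewrite eq_sym; exact/negbTE.
  have pv : dotv p (v j) = \sum_(i < m.+1) c i j ^+ 2.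
    by rewrite dotv_suml; apply: eq_bigr => i _; rewrite dotvZl expr2.
  have := dotvv_ge0 (v j - p).
  rewrite dotvBl !dotvBr (dotvC _ p) pv pp vo// eqxx /= mulr1n; lra.
apply: le_trans (ler_sum _ (fun i _ => parts i)).
rewrite big_split/= exchange_big/= -big_split/=.
apply: ler_sum => j _; rewrite -mulr_sumr.
have : alpha j <= alpha m by apply: als; rewrite ltnS leqnn -ltnS ltn_ord.
have := bessel j; set s := \sum_(i < m.+1) _; nra.
Qed.

End SymmetricMinimisation.

(** * Ultrafilter limits and dominated sums *)

(** An ultrafilter supplies limits of all the eigenvalues and of all the
    coefficients of the Galerkin eigenvectors at the same time, in place of a
    diagonal subsequence. *)
Lemma bounded_cvg_ultra (R : realType) (T : Type) (U : set_system T) (u : T -> R) (C : R) :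
  UltraFilter U -> (\forall t \near U, `|u t| <= C) -> exists l : R, u t @[t --> U] --> l.
Proof.
move=> UU uC.
have FU : UltraFilter (u @ U).
  split=> [|G GP UG]; first exact: fmap_proper_filter.
  apply/seteqP; split => // A GA.
  have [//|nA] := in_ultra_setVsetC (u @^-1` A) UU.
  have GnA : G (~` A) by apply: UG.
  have GI : G (A `&` ~` A) by exact: filterI.
  by have [x []] := filter_ex GI.
have : compact `[- C, C]%classic by exact: segment_compact.
rewrite compact_ultra => /(_ _ FU)[|l [_ ul]]; last by exists l.
by apply: filterS uC => t /=; rewrite in_itv/= ler_norml.
Qed.

Lemma series_bounded_tail (R : realType) (b : nat -> R) (K : R) :
  (forall j, 0 <= b j) -> (forall n, \sum_(j < n) b j <= K) ->
  forall e, 0 < e -> exists J, forall n, \sum_(J <= j < n) b j <= e.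
Proof.
move=> b0 bK e e0.
have nd : nondecreasing_seq (series b).
  by apply/nondecreasing_seqP => n; rewrite /series/= big_nat_recr//= lerDl.
have cb : cvgn (series b).
  apply: nondecreasing_is_cvgn => //; exists K => _ [n _ <-].
  by rewrite /series/= big_mkord.
have /cvgrPdist_le/(_ e e0)[J _ HJ] := cb.
exists J => n; have [Jn|nJ] := leqP J n; last by rewrite big_geq ?ltW// ltnW.
have := HJ J (leqnn J); rewrite /= => h.
have hn : series b n <= limn (series b) by exact: nondecreasing_cvgn_le.
have hJ : series b J <= limn (series b) by exact: nondecreasing_cvgn_le.
rewrite ger0_norm ?subr_ge0// in h.
have : series b n = series b J + \sum_(J <= j < n) b j.
  by rewrite /series/= -big_cat_nat.
lra.
Qed.

Lemma ler_norm_sum_dominated (R : realType) (I : Type) (r : seq I) (a b : I -> R) :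
  (forall i, `|a i| <= b i) -> `|\sum_(i <- r) a i| <= \sum_(i <- r) b i.
Proof. by move=> ab; rewrite (le_trans (ler_norm_sum _ _ _))//; exact: ler_sum. Qed.

(** Tannery's theorem, along an arbitrary filter: the passage to the limit
    under a dominated sum whose number of terms also grows. *)
Lemma tannery (R : realType) (T : Type) (F : set_system T) (FF : ProperFilter F)
    (N : T -> nat) (a : T -> nat -> R) (l b : nat -> R) (K : R) :
  (forall n, \sum_(j < n) b j <= K) ->
  (\forall t \near F, forall j, `|a t j| <= b j) ->
  (forall j, a t j @[t --> F] --> l j) ->
  (forall n, \forall t \near F, (n <= N t)%N) ->
  exists2 S : R, (fun n => \sum_(j < n) l j) @ \oo --> S &
    \sum_(j < N t) a t j @[t --> F] --> S.
Proof.
move=> bK ab al NF.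
have b0 j : 0 <= b j.
  by have [t /(_ j)] := filter_ex ab; apply: le_trans.
have tail := series_bounded_tail b0 bK.
have lb j : `|l j| <= b j.
  have cl : `|a t j| @[t --> F] --> `|l j| by apply: cvg_norm; exact: al.
  apply: (cvgr_to_le cl).
  by apply: filterS ab.
have cl : cvgn (series l).
  apply: normed_cvg; apply: nondecreasing_is_cvgn.
    by apply/nondecreasing_seqP => n /=; rewrite /series/= big_nat_recr//= lerDl.
  exists K => _ [n _ <-] /=; rewrite /series/= big_mkord; apply: le_trans (bK n).
  exact: ler_sum.
have Sn J n : (J <= n)%N -> forall c : nat -> R,
    \sum_(j < n) c j = \sum_(j < J) c j + \sum_(J <= j < n) c j.
  by move=> Jn c; rewrite -!(big_mkord xpredT c) -big_cat_nat.
have lS : (fun n => \sum_(j < n) l j) @ \oo --> limn (series l).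
  rewrite (_ : (fun n => _) = series l)//.
  by apply/funext => n; rewrite /series/= big_mkord.
exists (limn (series l)) => //; set S := limn _ in lS *.
apply/cvgrPdist_le => e e0.
have e4 : 0 < e / 4 by rewrite divr_gt0.
have [J HJ] := tail _ e4.
have dom (c : nat -> R) n : (forall j, `|c j| <= b j) -> `|\sum_(J <= j < n) c j| <= e / 4.
  by move=> cb; apply: le_trans (HJ n); exact: ler_norm_sum_dominated.
have SJ : `|S - \sum_(j < J) l j| <= e / 4.
  have cn : `|\sum_(j < n) l j - \sum_(j < J) l j| @[n --> \oo] --> `|S - \sum_(j < J) l j|.
    by apply: cvg_norm; apply: cvgB => //; exact: cvg_cst.
  apply: (cvgr_to_le cn); near=> n.
  rewrite (Sn J n); last by near: n; exact: nbhs_infty_ge.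
  by rewrite addrC addKr; exact: dom.
have aJ : \sum_(j < J) a t j @[t --> F] --> \sum_(j < J) l j.
  by apply: cvg_sumr => j _; exact: al.
have /cvgrPdist_le/(_ _ e4) aJe := aJ.
near=> t.
have Jt : (J <= N t)%N by near: t; exact: NF.
have abt : forall j, `|a t j| <= b j by near: t; exact: ab.
have ht : `|\sum_(j < J) l j - \sum_(j < J) a t j| <= e / 4 by near: t; exact: aJe.
have h2 := dom _ (N t) abt.
rewrite (Sn J _ Jt (a t)).
move: SJ ht h2; rewrite !ler_norml; lra.
Unshelve. all: by end_near. Qed.

(** Telescoping: 1 / (k + 1)^2 <= 1 / k - 1 / (k + 1). *)
Lemma sum_inv_sqr_le2 (R : realType) n : \sum_(j < n) (j.+1%:R ^- 2 : R) <= 2.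
Proof.
have h k : \sum_(j < k.+1) (j.+1%:R ^- 2 : R) <= 2 - k.+1%:R^-1.
  elim: k => [|k IH]; first by rewrite big_ord_recr big_ord0/= invr1 expr1n invr1; lra.
  rewrite big_ord_recr/=; apply: le_trans (lerD IH (lexx _)) _.
  have x0 : 0 < k.+1%:R :> R by rewrite ltr0n.
  rewrite -(natr1 k.+1) -subr_ge0; set x := k.+1%:R in x0 *.
  rewrite [leRHS](_ : _ = (x * (x + 1) ^+ 2)^-1); last first.
    by field; lra.
  by rewrite invr_ge0 mulr_ge0 ?sqr_ge0// ltW.
case: n => [|n]; first by rewrite big_ord0.
by apply: le_trans (h n) _; rewrite lerBlDr lerDl invr_ge0.
Qed.

(** * Truncated eigenvalue problems *)

Section Galerkin.
Context {R : realType} (D : nat -> R) (B : nat -> nat -> R) (M : R).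
Hypothesis D_ge0 : forall l, 0 <= D l.
Hypothesis D_growth : forall l, l.+1%:R ^+ 2 <= 2 * (D l + 1).
Hypothesis B_sym : forall j l, B j l = B l j.
Hypothesis B_rows : forall j n, \sum_(l < n) `|B j l| <= M.

(** The matrix of - u'' + q u in an orthonormal basis that diagonalises
    - u'' with eigenvalues [D], when [B] is the matrix of multiplication by
    [q]. *)
Definition schrodinger_coef (j l : nat) : R := (j == l)%:R * D j + B j l.

Definition schrodinger_form (N : nat) (x : nat -> R) : R :=
  \sum_(j < N) \sum_(l < N) x j * schrodinger_coef j l * x l.

Lemma galerkin_eigenvectors (m N : nat) : (m <= N)%N ->
  exists (a : nat -> R) (w : nat -> nat -> R),
  [/\ forall i j, (i <= j < m)%N -> a i <= a j,
      forall i l, (N <= l)%N -> w i l = 0,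
      forall i k, (i < m)%N -> (k < m)%N ->
        \sum_(l < N) w i l * w k l = (i == k)%:R,
      forall i l, (i < m)%N -> (l < N)%N ->
        D l * w i l + \sum_(j < N) B l j * w i j = a i * w i l &
      forall phi : nat -> nat -> R,
        (forall i k, (i < m)%N -> (k < m)%N ->
          \sum_(l < N) phi i l * phi k l = (i == k)%:R) ->
        \sum_(i < m) a i <= \sum_(i < m) schrodinger_form N (phi i)].
Proof.
move=> mN; pose A : 'M[R]_N := \matrix_(j, l) schrodinger_coef j l.
have symA : A^T = A.
  apply/matrixP => j l; rewrite !mxE /schrodinger_coef B_sym eq_sym.
  by case: eqVneq => [->|]//; rewrite !mul0r.
have [a [v [als vo va vmin]]] := min_eigenvectors symA mN.
pose ext (x : 'rV[R]_N) (l : nat) : R := if insub l is Some i then x 0 i else 0.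
have extE x (l : 'I_N) : ext x l = x 0 l by rewrite /ext valK.
exists a, (fun i => ext (v i)); split => //.
- by move=> i l Nl; rewrite /ext insubF// ltnNge Nl.
- move=> i k im km; rewrite -(vo i k im km); apply: eq_bigr => l _.
  by rewrite !extE.
- move=> i l im lN; have := congr1 (fun x : 'rV[R]_N => x 0 (Ordinal lN)) (va i im).
  rewrite !mxE -(extE _ (Ordinal lN))/= => <-.
  rewrite [RHS](eq_bigr (fun j : 'I_N =>
    (nat_of_ord j == l)%:R * (D j * ext (v i) j) + B l j * ext (v i) j)); last first.
    by move=> j _; rewrite !mxE extE /schrodinger_coef (B_sym l)/=; ring.
  rewrite big_split/=; congr (_ + _).
  rewrite (bigD1 (Ordinal lN))//= eqxx mul1r big1 ?addr0// => j jl.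
  by rewrite (_ : (nat_of_ord j == l) = false) ?mul0r//; exact: negbTE.
- move=> phi phio; pose p i : 'rV[R]_N := \row_j phi i j.
  rewrite [leRHS](_ : _ = \sum_(i < m) dotv (p i *m A) (p i)).
    apply: (trace_inequality symA als vo va vmin) => i j im jm.
    by rewrite -(phio i j im jm); apply: eq_bigr => l _; rewrite !mxE.
  apply: eq_bigr => i _; rewrite dotv_mulmx; apply: eq_bigr => j _.
  by apply: eq_bigr => l _; rewrite !mxE.
Qed.

Let M_ge0 : 0 <= M.
Proof. by have := B_rows 0 0; rewrite big_ord0. Qed.

Let B_le j l : `|B j l| <= M.
Proof.
apply: le_trans (B_rows j l.+1); rewrite big_ord_recr/= lerDr.
exact: sumr_ge0.
Qed.

(** Schur's test: |b u w| <= |b| (u^2 + w^2) / 2, summed along the rows for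
    one square and along the columns for the other. *)
Lemma perturbation_form_bound (N : nat) (x : nat -> R) :
  - M * \sum_(l < N) x l ^+ 2 <= \sum_(l < N) \sum_(j < N) x l * B l j * x j.
Proof.
pose S := \sum_(l < N) \sum_(j < N) `|B l j| * x l ^+ 2.
have SM : S <= M * \sum_(l < N) x l ^+ 2.
  rewrite mulr_sumr; apply: ler_sum => l _; rewrite -mulr_suml.
  by rewrite ler_wpM2r ?sqr_ge0.
have S' : S = \sum_(l < N) \sum_(j < N) `|B l j| * x j ^+ 2.
  rewrite exchange_big; apply: eq_bigr => j _; apply: eq_bigr => l _.
  by rewrite B_sym.
rewrite mulNr lerNl; apply: le_trans SM.
rewrite -[leRHS](_ : (S + S) / 2 = _); last by field.
rewrite {1}S' /S -big_split mulr_suml -sumrN; apply: ler_sum => l _.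
rewrite -big_split mulr_suml -sumrN; apply: ler_sum => j _ /=.
have := ler_norm (B l j); have := ler_norm (- B l j); rewrite normrN.
set b := `|_|; set u := x l; set w := x j => h1 h2.
have b0 : 0 <= b by exact: normr_ge0.
have : 0 <= (b + B l j) * (u + w) ^+ 2 by rewrite mulr_ge0 ?sqr_ge0//; lra.
have : 0 <= (b - B l j) * (u - w) ^+ 2 by rewrite mulr_ge0 ?sqr_ge0//; lra.
lra.
Qed.

(** The point of this bound, and of the next one, is that they do not depend
    on the size of the truncated matrix. *)
Definition eigenvalue_bound (m : nat) : R :=
  `|\sum_(k < m) schrodinger_coef k k| + m.+1%:R * M.

Definition decay_const m : R := 2 * (eigenvalue_bound m + M + 1).

(** Each eigenvalue is at least [- M], and the sum of all of them is at most
    the trace over the first [m] basis vectors; this bounds each of them. The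
    eigenvalue equation then trades the growth of [D] for decay of the
    coefficients: pointwise first and, since [B] is bounded on summable
    sequences, in the weighted sum as well. *)
Lemma galerkin_bounds (m N : nat) (a : nat -> R) (w : nat -> nat -> R) :
  (m <= N)%N ->
  (forall i l, (N <= l)%N -> w i l = 0) ->
  (forall i k, (i < m)%N -> (k < m)%N ->
        \sum_(l < N) w i l * w k l = (i == k)%:R) ->
  (forall i l, (i < m)%N -> (l < N)%N ->
        D l * w i l + \sum_(j < N) B l j * w i j = a i * w i l) ->
  (forall phi : nat -> nat -> R,
        (forall i k, (i < m)%N -> (k < m)%N ->
          \sum_(l < N) phi i l * phi k l = (i == k)%:R) ->
        \sum_(i < m) a i <= \sum_(i < m) schrodinger_form N (phi i)) ->
  forall i, (i < m)%N -> [/\ `|a i| <= eigenvalue_bound m,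
    forall l, `|w i l| <= decay_const m * l.+1%:R ^- 2 &
    \sum_(l < N) (1 + D l) * `|w i l| <=
      (1 + eigenvalue_bound m + M) * (decay_const m * 2)].
Proof.
move=> mN w0 wo wa wtr.
have w1 i : (i < m)%N -> \sum_(l < N) w i l ^+ 2 = 1.
  by move=> im; have := wo i i im im; rewrite eqxx; under eq_bigr do rewrite -expr2.
have a_ge i : (i < m)%N -> - M <= a i.
  move=> im; have -> : a i = \sum_(l < N) D l * w i l ^+ 2 +
      \sum_(l < N) \sum_(j < N) w i l * B l j * w i j.
    rewrite -[LHS]mulr1 -(w1 i im) mulr_sumr -big_split; apply: eq_bigr => l _ /=.
    rewrite expr2 mulrA -wa// mulrDl mulrA; congr (_ + _); rewrite mulr_suml.
    by apply: eq_bigr => j _; ring.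
  have := perturbation_form_bound N (w i); rewrite w1// mulr1.
  have : 0 <= \sum_(l < N) D l * w i l ^+ 2.
    by apply: sumr_ge0 => l _; rewrite mulr_ge0 ?sqr_ge0.
  lra.
have atr : \sum_(i < m) a i <= \sum_(k < m) schrodinger_coef k k.
  apply: le_trans (wtr (fun i l => (i == l)%:R) _) _.
    move=> i k im km; rewrite (bigD1 (Ordinal (leq_trans im mN)))//=.
    rewrite eqxx mul1r eq_sym big1 ?addr0// => l /negbTE li.
    by rewrite (_ : (i == l) = false) ?mul0r// eq_sym.
  apply: ler_sum => i _.
  have iN := leq_trans (ltn_ord i) mN.
  rewrite /schrodinger_form (bigD1 (Ordinal iN))//= [X in _ + X]big1 ?addr0; last first.
    move=> j /negbTE ji; rewrite big1// => l _.
    by rewrite (_ : (nat_of_ord i == j) = false) ?mul0r// eq_sym.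
  rewrite (bigD1 (Ordinal iN))//= [X in _ + X]big1 ?addr0; last first.
    move=> j /negbTE ji.
    by rewrite (_ : (nat_of_ord i == j) = false) ?mulr0// eq_sym.
  by rewrite eqxx mulr1 mul1r.
have aB i : (i < m)%N -> `|a i| <= eigenvalue_bound m.
  move=> im; rewrite ler_norml; apply/andP; split.
    apply: le_trans (a_ge i im); rewrite lerN2 /eigenvalue_bound -natr1.
    have : 0 <= m%:R * M by rewrite mulr_ge0.
    have := normr_ge0 (\sum_(k < m) schrodinger_coef k k); lra.
  have : a i - m%:R * M <= \sum_(i < m) a i.
    rewrite (bigD1 (Ordinal im))//= lerD2l.
    apply: (@le_trans _ _ (\sum_(k < m | k != Ordinal im) - M)).
      rewrite sumr_const -[leRHS]mulr_natl mulrN lerN2 ler_wpM2r// ler_nat.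
      by apply: leq_trans (max_card _) _; rewrite card_ord.
    by apply: ler_sum => k _; exact: a_ge.
  have := ler_norm (\sum_(k < m) schrodinger_coef k k).
  rewrite /eigenvalue_bound -natr1; move: M_ge0; lra.
have w_le1 i l : (i < m)%N -> `|w i l| <= 1.
  move=> im; have [lN|/w0->] := ltnP l N; last by rewrite normr0.
  rewrite -(@ler_pXn2r _ 2) ?nnegrE// expr1n real_normK ?num_real//.
  rewrite -(w1 i im) (bigD1 (Ordinal lN))//= lerDl.
  by apply: sumr_ge0 => k _; exact: sqr_ge0.
have Bw i l n : (i < m)%N -> `|\sum_(j < n) B l j * w i j| <= M.
  move=> im; apply: le_trans (B_rows l n); apply: ler_norm_sum_dominated => j.
  by rewrite normrM ler_piMr// w_le1.
have eb0 : 0 <= eigenvalue_bound m by rewrite addr_ge0// mulr_ge0.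
move=> i im.
have dec l : `|w i l| <= decay_const m * l.+1%:R ^- 2.
  have [lN|/w0->] := ltnP l N; last first.
    by rewrite normr0 !mulr_ge0// ?invr_ge0 ?exprn_ge0//; move: M_ge0; lra.
  rewrite ler_pdivlMr ?exprn_gt0 ?ltr0n//.
  apply: le_trans (ler_wpM2l (normr_ge0 _) (D_growth l)) _.
  have : D l * `|w i l| <= eigenvalue_bound m + M.
    rewrite -{1}[D l]ger0_norm// -normrM.
    have -> : D l * w i l = a i * w i l - \sum_(j < N) B l j * w i j.
      by rewrite -wa// addrK.
    apply: le_trans (ler_normB _ _) _; apply: lerD; last exact: Bw.
    rewrite normrM; apply: le_trans (aB i im).
    by rewrite ler_piMr// w_le1.
  have := w_le1 i l im; rewrite /decay_const; lra.
split => //; first exact: aB.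
have dc0 : 0 <= decay_const m by rewrite /decay_const; move: M_ge0; lra.
have sw : \sum_(l < N) `|w i l| <= decay_const m * 2.
  apply: le_trans (ler_wpM2l dc0 (sum_inv_sqr_le2 R N)).
  by rewrite mulr_sumr; apply: ler_sum => l _.
apply: le_trans (ler_wpM2l _ sw); last by move: M_ge0; lra.
have -> : (1 + eigenvalue_bound m + M) * \sum_(l < N) `|w i l| =
   \sum_(l < N) (1 + eigenvalue_bound m) * `|w i l| + \sum_(j < N) M * `|w i j|.
  by rewrite -!mulr_sumr mulrDl.
apply: (@le_trans _ _ (\sum_(l < N) (1 + eigenvalue_bound m) * `|w i l| +
    \sum_(j < N) \sum_(l < N) `|B l j| * `|w i j|)).
  rewrite exchange_big -big_split; apply: ler_sum => l _ /=.
  rewrite mulrDl mul1r mulrDl mul1r -addrA lerD2l.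
  rewrite -{1}[D l]ger0_norm// -normrM.
  have -> : D l * w i l = a i * w i l - \sum_(j < N) B l j * w i j.
    by rewrite -wa// addrK.
  apply: le_trans (ler_normB _ _) _; apply: lerD.
    by rewrite normrM ler_wpM2r// aB.
  by apply: ler_norm_sum_dominated => j; rewrite normrM.
rewrite lerD2l; apply: ler_sum => j _; rewrite -mulr_suml ler_wpM2r//.
by under eq_bigr do rewrite B_sym.
Qed.

End Galerkin.

(** * The limit of the truncated problems *)

Lemma sum_ord_widen (V : nmodType) (F : nat -> V) (N N' : nat) : (N <= N')%N ->
  (forall l, (N <= l)%N -> F l = 0) -> \sum_(l < N') F l = \sum_(l < N) F l.
Proof.
move=> NN' F0; rewrite -!(big_mkord xpredT F) (big_cat_nat _ NN')//=.
rewrite [X in _ + X]big1_seq ?addr0// => l /andP[_].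
by rewrite mem_index_iota => /andP[Nl _]; exact: F0.
Qed.

Section Limit.
Context {R : realType} (D : nat -> R) (B : nat -> nat -> R) (M : R).
Hypothesis D_ge0 : forall l, 0 <= D l.
Hypothesis D_growth : forall l, l.+1%:R ^+ 2 <= 2 * (D l + 1).
Hypothesis B_sym : forall j l, B j l = B l j.
Hypothesis B_rows : forall j n, \sum_(l < n) `|B j l| <= M.

Lemma schrodinger_form_widen (N N' : nat) (x : nat -> R) : (N <= N')%N ->
  (forall l, (N <= l)%N -> x l = 0) ->
  schrodinger_form D B N' x = schrodinger_form D B N x.
Proof.
move=> NN' x0; rewrite /schrodinger_form.
rewrite (sum_ord_widen NN' (F := fun j => \sum_(l < N') x j * schrodinger_coef D B j l * x l)).
  apply: eq_bigr => j _.
  rewrite (sum_ord_widen NN' (F := fun l => x j * schrodinger_coef D B j l * x l))// => l Nl.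
  by rewrite (x0 l)// mulr0.
by move=> j Nj; apply: big1 => l _; rewrite x0// !mul0r.
Qed.

(** The truncated eigenvectors are dominated by a fixed summable sequence, so
    orthonormality and the eigenvalue equation pass to the limit by Tannery's
    theorem. The trace inequality passes to the limit because trial vectors
    of length [N] remain admissible in every larger truncation. *)
Lemma variational_eigenvectors (m : nat) :
  exists (alpha : nat -> R) (v : nat -> nat -> R) (K : R),
  [/\ forall i j, (i <= j < m)%N -> alpha i <= alpha j,
      forall i L, (i < m)%N -> \sum_(l < L) (1 + D l) * `|v i l| <= K,
      forall i l, (i < m)%N -> (fun n => \sum_(j < n) B l j * v i j) @ \oo -->
        (alpha i - D l) * v i l,
      forall i k, (i < m)%N -> (k < m)%N ->
        (fun n => \sum_(l < n) v i l * v k l) @ \oo --> ((i == k)%:R : R) &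
      forall (N : nat) (phi : nat -> nat -> R),
        (forall i k, (i < m)%N -> (k < m)%N ->
          \sum_(l < N) phi i l * phi k l = (i == k)%:R) ->
        \sum_(i < m) alpha i <= \sum_(i < m) schrodinger_form D B N (phi i)].
Proof.
have gal N : exists aw : (nat -> R) * (nat -> nat -> R), (m <= N)%N ->
    [/\ forall i j, (i <= j < m)%N -> aw.1 i <= aw.1 j,
      forall i l, (N <= l)%N -> aw.2 i l = 0,
      forall i k, (i < m)%N -> (k < m)%N ->
        \sum_(l < N) aw.2 i l * aw.2 k l = (i == k)%:R,
      forall i l, (i < m)%N -> (l < N)%N ->
        D l * aw.2 i l + \sum_(j < N) B l j * aw.2 i j = aw.1 i * aw.2 i l &
      forall phi : nat -> nat -> R,
        (forall i k, (i < m)%N -> (k < m)%N ->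
          \sum_(l < N) phi i l * phi k l = (i == k)%:R) ->
        \sum_(i < m) aw.1 i <= \sum_(i < m) schrodinger_form D B N (phi i)].
  have [mN|_] := leqP m N; last by exists (fun=> 0, fun _ _ => 0).
  have [a [w h]] := galerkin_eigenvectors D B_sym mN.
  by exists (a, w).
have {gal}[aw gal] := choice gal.
pose a N := (aw N).1; pose w N := (aw N).2.
have bnd N i : (m <= N)%N -> (i < m)%N ->
    [/\ `|a N i| <= eigenvalue_bound D B M m,
    forall l, `|w N i l| <= decay_const D B M m * l.+1%:R ^- 2 &
    \sum_(l < N) (1 + D l) * `|w N i l| <=
      (1 + eigenvalue_bound D B M m + M) * (decay_const D B M m * 2)].
  move=> mN im; have [_ h1 h2 h3 h4] := gal N mN.
  exact: (galerkin_bounds D_ge0 D_growth B_sym B_rows mN h1 h2 h3 h4).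
set K := (1 + _ + M) * _ in bnd.
have [U [UU ooU]] := @ultraFilterLemma nat \oo _.
have UP : ProperFilter U by exact: ultra_proper.
have Uge n : \forall N \near U, (n <= N)%N by apply: ooU; exact: nbhs_infty_ge.
have ex_alpha i : exists l : R, (i < m)%N -> a N i @[N --> U] --> l.
  have [im|_] := ltnP i m; last by exists 0.
  have [l al] := @bounded_cvg_ultra R nat U (a^~ i) (eigenvalue_bound D B M m) UU
    (filterS (fun N mN => let: And3 h _ _ := bnd N i mN im in h) (Uge m)).
  by exists l.
have [alpha alphaE] := choice ex_alpha.
have ex_v i : exists v : nat -> R, (i < m)%N -> forall l, w N i l @[N --> U] --> v l.
  have [im|_] := ltnP i m; last by exists (fun=> 0).
  have ex l : exists v : R, w N i l @[N --> U] --> v.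
    exact: (@bounded_cvg_ultra R nat U _ _ UU
      (filterS (fun N mN => let: And3 _ h _ := bnd N i mN im in h l) (Uge m))).
  by have [v vE] := choice ex; exists v.
have [v vE] := choice ex_v.
pose dc := decay_const D B M m.
have dc0 i : (i < m)%N -> 0 <= dc.
  move=> im; have [_ /(_ 0%N) + _] := bnd m i (leqnn m) im.
  by rewrite expr1n invr1 mulr1; apply: le_trans.
have sum_dom (c : R) n : 0 <= c -> \sum_(j < n) c * j.+1%:R ^- 2 <= c * 2.
  by move=> c0; apply: le_trans (ler_wpM2l c0 (sum_inv_sqr_le2 R n)); rewrite mulr_sumr.
have M0 : 0 <= M by have := B_rows 0 0; rewrite big_ord0.
have B_le j l : `|B j l| <= M.
  apply: le_trans (B_rows j l.+1); rewrite big_ord_recr/= lerDr.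
  exact: sumr_ge0.
have w_le N i l : (m <= N)%N -> (i < m)%N -> `|w N i l| <= dc * l.+1%:R ^- 2.
  by move=> mN im; have [_ + _] := bnd N i mN im; exact.
exists alpha, v, K; split.
- move=> i j /andP[ij jm]; have im := leq_ltn_trans ij jm.
  have c : a N j - a N i @[N --> U] --> alpha j - alpha i.
    by apply: cvgB; exact: alphaE.
  rewrite -subr_ge0; apply: (cvgr_to_ge c); apply: filterS (Uge m) => N mN.
  by have [h _ _ _ _] := gal N mN; rewrite /= subr_ge0 h// ij.
- move=> i L im.
  have c : \sum_(l < L) (1 + D l) * `|w N i l| @[N --> U] -->
         \sum_(l < L) (1 + D l) * `|v i l|.
    apply: cvg_sumr => l _; apply: cvgM; first exact: cvg_cst.
    by apply: cvg_norm; exact: vE.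
  apply: (cvgr_to_le c); apply: filterS2 (Uge m) (Uge L) => N mN LN.
  have [_ _] := bnd N i mN im; apply: le_trans.
  rewrite -!(big_mkord xpredT (fun l => (1 + D l) * `|w N i l|)).
  rewrite (big_cat_nat _ LN)//= lerDl; apply: sumr_ge0 => l _.
  by rewrite mulr_ge0// addr_ge0.
- move=> i l im.
  have dom : \forall N \near U, forall j,
      `|B l j * w N i j| <= M * dc * j.+1%:R ^- 2.
    apply: filterS (Uge m) => N mN j.
    by rewrite normrM -mulrA; apply: ler_pM => //; exact: w_le.
  have lim j : B l j * w N i j @[N --> U] --> B l j * v i j.
    by apply: cvgM; [exact: cvg_cst|exact: vE].
  have [S lS SU] := tannery UP (N := id)
    (fun n => sum_dom _ n (mulr_ge0 M0 (dc0 i im))) dom lim Uge.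
  suff <- : S = (alpha i - D l) * v i l by [].
  have cU : (a N i - D l) * w N i l @[N --> U] --> (alpha i - D l) * v i l.
    apply: cvgM; last exact: vE.
    by apply: cvgB; [exact: alphaE|exact: cvg_cst].
  apply: (cvg_unique _ SU); first exact: Rhausdorff.
  apply: cvg_trans cU; apply: near_eq_cvg.
  apply: filterS2 (Uge m) (Uge l.+1) => N mN lN.
  have [_ _ _ /(_ i l im lN) h _] := gal N mN.
  by rewrite /= mulrBl -h addrC addKr.
- move=> i k im km.
  have dom : \forall N \near U, forall j,
      `|w N i j * w N k j| <= dc * dc * j.+1%:R ^- 2.
    apply: filterS (Uge m) => N mN j; rewrite normrM.
    apply: le_trans (ler_pM _ _ (w_le N i j mN im) (w_le N k j mN km)) _ => //.
    have := dc0 i im; set x := j.+1%:R ^- 2 => c0.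
    have x0 : 0 <= x by rewrite invr_ge0 exprn_ge0.
    have x1 : x <= 1 by rewrite invf_le1 ?exprn_gt0 ?ltr0n// exprn_ege1// ler1n.
    rewrite mulrACA; apply: ler_wpM2l; first exact: mulr_ge0.
    by rewrite ler_piMl.
  have lim j : w N i j * w N k j @[N --> U] --> v i j * v k j.
    by apply: cvgM; exact: vE.
  have [S lS SU] := tannery UP (N := id)
    (fun n => sum_dom _ n (mulr_ge0 (dc0 i im) (dc0 i im))) dom lim Uge.
  suff <- : S = (i == k)%:R by [].
  apply: (cvg_unique _ SU); first exact: Rhausdorff.
  apply: cvg_near_cst; apply: filterS (Uge m) => N mN.
  by have [_ _ h _ _] := gal N mN; rewrite /= h.
- move=> N phi phio.
  have c : \sum_(i < m) a N' i @[N' --> U] --> \sum_(i < m) alpha i.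
    by apply: cvg_sumr => i _; exact: alphaE.
  apply: (cvgr_to_le c); apply: filterS2 (Uge m) (Uge N) => N' mN' NN'.
  pose phi' i l := if (l < N)%N then phi i l else 0.
  have phi'0 i l : (N <= l)%N -> phi' i l = 0 by rewrite /phi' leqNgt => /negbTE->.
  have [_ _ _ _ h] := gal N' mN'; apply: le_trans (h phi' _) _.
    move=> i k im km; rewrite -(phio i k im km).
    rewrite (sum_ord_widen NN' (F := fun l => phi' i l * phi' k l)).
      by apply: eq_bigr => l _; rewrite /phi' ltn_ord.
    by move=> l Nl; rewrite phi'0// mul0r.
  apply: ler_sum => i _; rewrite (schrodinger_form_widen NN'); last exact: phi'0.
  rewrite le_eqVlt; apply/orP; left; apply/eqP.
  by apply: eq_bigr => j _; apply: eq_bigr => l _; rewrite /phi' !ltn_ord.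
Qed.

End Limit.

(** * Integrals over the interval *)

Section IntegralTools.
Context {R : realType}.
Local Notation mu := (@lebesgue_measure R).
Implicit Types (A : set R) (u v g h k : R -> R).

Lemma measurable_dom : measurable (dom R).
Proof. exact: measurable_itv. Qed.

Lemma finite_measure_dom : (mu (dom R) < +oo)%E.
Proof. by rewrite /dom lebesgue_measure_itv/= lte_fin pi_gt0 -EFinB ltry. Qed.

Lemma domP x : dom R x <-> 0 <= x <= pi.
Proof. by rewrite /dom/= in_itv. Qed.

Lemma bounded_onP A h (C : R) : (forall x, A x -> `|h x| <= C) ->
  [bounded h x | x in A].
Proof.
move=> hC; exists C; split; first exact: num_real.
by move=> r Cr x Ax /=; apply: le_trans (hC x Ax) (ltW Cr).
Qed.

Lemma integrable_bounded A h (C : R) : A `<=` dom R -> measurable A ->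
  measurable_fun A h -> (forall x, A x -> `|h x| <= C) ->
  mu.-integrable A (EFin \o h).
Proof.
move=> Adom mA mh hC; apply: measurable_bounded_integrable => //.
  apply: le_lt_trans finite_measure_dom.
  by apply: le_measure; rewrite ?inE//; exact: measurable_dom.
exact: bounded_onP hC.
Qed.

Lemma integrable_bounded_mul A h k (C : R) : measurable A ->
  measurable_fun A h -> (forall x, A x -> `|h x| <= C) ->
  mu.-integrable A (EFin \o k) ->
  mu.-integrable A (EFin \o (fun x => h x * k x)).
Proof.
move=> mA mh hC ik.
exact: (@integrableMr _ _ R mu A mA h _ mh (bounded_onP hC) ik).
Qed.

(** The interval has finite measure and |g| <= 1 + g^2. *)
Lemma L2_integrable g : L2 g -> mu.-integrable (dom R) (EFin \o g).
Proof.
move=> [mg ig]; have mdom := measurable_dom.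
have i1 : mu.-integrable (dom R) (EFin \o cst (1 : R)).
  by apply: (@integrable_bounded _ _ 1) => // x _; rewrite normr1.
have : mu.-integrable (dom R) (fun x => (cst 1 x)%:E + (g x ^+ 2)%:E)%E.
  exact: integrableD.
apply: le_integrable => //; first exact/measurable_EFinP.
move=> x _ /=; rewrite lee_fin [leRHS]ger0_norm; last first.
  by rewrite addr_ge0// sqr_ge0.
have := sqr_ge0 (`|g x| - 1); rewrite -(real_normK (num_real (g x))).
have := sqr_ge0 `|g x|; have := normr_ge0 (g x); rewrite !expr2; lra.
Qed.

Lemma bounded_convergence A (s : nat -> R -> R) h k (C : R) : measurable A ->
  (forall n, measurable_fun A (s n)) ->
  (forall n x, A x -> `|s n x| <= C) ->
  (forall x, A x -> s ^~ x @ \oo --> h x) ->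
  mu.-integrable A (EFin \o k) ->
  (fun n => \int[mu]_(x in A) (s n x * k x)) @ \oo -->
    \int[mu]_(x in A) (h x * k x).
Proof.
move=> mA ms sC sh ik.
have mh : measurable_fun A h by exact: measurable_fun_cvg sh.
have mk : measurable_fun A k by apply/measurable_EFinP; case/integrableP : ik.
have iCk : mu.-integrable A (fun x => (C%:E * `|(k x)%:E|)%E).
  by apply: integrableZl => //; exact: integrable_abse.
have mf n : measurable_fun A (fun x => (s n x * k x)%:E).
  by apply/measurable_EFinP; exact: measurable_funM.
have mhk : measurable_fun A (fun x => (h x * k x)%:E).
  by apply/measurable_EFinP; exact: measurable_funM.
have cvx x : A x -> (fun n => (s n x * k x)%:E) @ \oo --> (h x * k x)%:E.
  move=> Ax; apply: cvg_EFin; first exact: nearW.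
  by apply: cvgM; [exact: sh|exact: cvg_cst].
have dom x n : A x -> (`|(s n x * k x)%:E| <= C%:E * `|(k x)%:E|)%E.
  by move=> Ax; rewrite /= -EFinM lee_fin normrM ler_wpM2r// sC.
have [ihk _ cv] := dominated_convergence (mu := mu) mA mf mhk (aeW mu cvx) iCk (aeW mu dom).
by apply: fine_cvg; rewrite fineK//; exact: integrable_fin_num ihk.
Qed.

End IntegralTools.

(** * Weak derivatives *)

Section WeakDerivatives.
Context {R : realType}.
Local Notation mu := (@lebesgue_measure R).
Implicit Types (A : set R) (u v g h k : R -> R).

Lemma weak_derivative_cont_bounded u g : weak_derivative u g ->
  measurable_fun (dom R) u /\ exists C : R, forall x, dom R x -> `|u x| <= C.
Proof.
move=> [Lg uE]; have ig := L2_integrable Lg.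
pose F x := u 0 + parameterized_integral mu 0 x g.
have cF : {within dom R, continuous F}.
  have cp := parameterized_integral_continuous (pi_ge0 R) ig.
  by move=> x; apply: cvgD; [exact: cvg_cst|exact: cp].
have uF x : dom R x -> u x = F x by move=> xd; rewrite uE// inE.
split.
  apply: (eq_measurable_fun F); first by move=> x /set_mem xd; rewrite uF.
  exact: subspace_continuous_measurable_fun measurable_dom cF.
have [C [_ HC]] := compact_bounded (continuous_compact cF (@segment_compact R 0 pi)).
exists (C + 1) => x xd; rewrite uF//.
by apply: (HC (C + 1)); [rewrite ltrDl|exists x].
Qed.

(** Lebesgue's differentiation theorem: the extension of [g] by zero has a
    vanishing primitive on the whole line. *)
Lemma integral_interval_eq0_ae g : mu.-integrable (dom R) (EFin \o g) ->
  (forall x, dom R x -> \int[mu]_(t in `[0, x]) g t = 0) ->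
  {ae mu, forall x, dom R x -> g x = 0}.
Proof.
move=> ig g0; pose f := g \_ (dom R).
have ifT : mu.-integrable setT (EFin \o f).
  rewrite /f -restrict_EFin.
  exact: ((integrable_mkcond (mu := mu) (EFin \o g) measurable_dom).1 ig).
have Ff x : \int[mu]_(t in `]-oo, x]) f t = 0.
  rewrite /f -Rintegral_mkcondr.
  have [x0|x0] := ltP x 0.
    rewrite (_ : _ `&` _ = set0) ?Rintegral_set0//; apply/seteqP; split => // t /=.
    rewrite /dom/= !in_itv/= => -[tx /andP[t0 _]].
    by have := lt_le_trans (le_lt_trans tx x0) t0; rewrite ltxx.
  have [xpi|pix] := leP x pi.
    rewrite (_ : _ `&` _ = `[0, x]%classic) ?g0//; first by apply/domP; rewrite x0.
    apply/seteqP; split => t /=; rewrite /dom/= !in_itv/=.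
      by move=> [-> /andP[->]].
    by move=> /andP[-> tx]; rewrite tx (le_trans tx xpi).
  rewrite (_ : _ `&` _ = `[0, pi]%classic) ?g0//; first by apply/domP; rewrite pi_ge0 lexx.
  apply/seteqP; split => t /=; rewrite /dom/= !in_itv/=; first by move=> [].
  by move=> /andP[-> tx]; rewrite tx (le_trans tx (ltW pix)).
have iy y : mu.-integrable `]-oo, y] (EFin \o f).
  by apply: integrableS ifT.
have := FTC1Ny iy (open_integrable_locally openT ifT).
apply: filterS; first exact: (ae_filter_ringOfSetsType mu).
move=> x [_]; rewrite (_ : (fun y => _) = cst 0); last first.
  by apply/funext => y; rewrite Ff.
by rewrite derive1_cst /f => fx xd; move: fx; rewrite patchE mem_set.
Qed.

(** The weak eigenvalue equation quantifies over all versions of the weak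
    derivative; this reduces it to a version of one's choice. *)
Lemma weak_derivative_unique u g1 g2 h :
  weak_derivative u g1 -> weak_derivative u g2 -> measurable_fun (dom R) h ->
  integral0pi (fun x => g1 x * h x) = integral0pi (fun x => g2 x * h x).
Proof.
move=> [L1 u1] [L2' u2] mh.
have i1 := L2_integrable L1; have i2 := L2_integrable L2'.
have ae0 : {ae mu, forall x, dom R x -> g1 x - g2 x = 0}.
  apply: (@integral_interval_eq0_ae (fun x => g1 x - g2 x)).
    exact: (integrableB (mu := mu) measurable_dom i1 i2).
  move=> x xd; have sub : `[0, x]%classic `<=` dom R.
    move=> t /=; rewrite /dom/= !in_itv/= => /andP[-> tx].
    by move/domP: xd => /andP[_]; exact: le_trans.
  rewrite RintegralB//; last 2 first.
  - by apply: integrableS i1 => //; exact: measurable_dom.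
  - by apply: integrableS i2 => //; exact: measurable_dom.
  have := u1 x (mem_set xd); rewrite u2 ?inE// => /addrI ->.
  by rewrite subrr.
rewrite /integral0pi /Rintegral; congr fine.
apply: ae_eq_integral; first exact: measurable_dom.
- by apply/measurable_EFinP/measurable_funM => //; case: L1.
- by apply/measurable_EFinP/measurable_funM => //; case: L2'.
apply: filterS ae0; first exact: (ae_filter_ringOfSetsType mu).
by move=> x /= h0 xd; have /eqP := h0 xd; rewrite subr_eq0 => /eqP ->.
Qed.

End WeakDerivatives.

(** * Integration by parts *)

Section TriangleFubini.
Context {R : realType}.
Local Notation mu := (@lebesgue_measure R).
Implicit Types (a w G v : R -> R).

Lemma EFin_Rintegral (A : set R) (f : R -> R) : measurable A ->
  mu.-integrable A (EFin \o f) ->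
  (\int[mu]_(x in A) (f x)%:E = (\int[mu]_(x in A) f x)%:E)%E.
Proof.
by move=> mA fi; rewrite /Rintegral fineK//; exact: integrable_fin_num fi.
Qed.

Lemma integral_scaled_restrict (A : set R) (f : R -> R) (c : R) : measurable A ->
  mu.-integrable A (EFin \o f) ->
  (\int[mu]_y (c * (f \_ A) y)%:E = (c * \int[mu]_(x in A) f x)%:E)%E.
Proof.
move=> mA fi.
have fiT : mu.-integrable setT (EFin \o (f \_ A)).
  rewrite -restrict_EFin.
  exact: ((integrable_mkcond (mu := mu) (EFin \o f) mA).1 fi).
rewrite Rintegral_mkcond -RintegralZl//.
by rewrite EFin_Rintegral//; exact: (integrableZl (mu := mu) measurableT c fiT).
Qed.

Lemma triangle_fubini a w (C : R) : measurable_fun (dom R) a ->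
  (forall x, dom R x -> `|a x| <= C) -> mu.-integrable (dom R) (EFin \o w) ->
  integral0pi (fun x => a x * \int[mu]_(t in `[0, x]) w t) =
  integral0pi (fun t => w t * \int[mu]_(x in `[t, pi]) a x).
Proof.
move=> ma aC iw; have mdom := @measurable_dom R.
have mw : measurable_fun (dom R) w by apply/measurable_EFinP; case/integrableP : iw.
pose a' : R -> R := a \_ (dom R); pose w' : R -> R := w \_ (dom R).
have ma' : measurable_fun setT a' by exact: ((measurable_restrictT a mdom).1 ma).
have mw' : measurable_fun setT w' by exact: ((measurable_restrictT w mdom).1 mw).
pose k (z : R * R) : R := if z.2 <= z.1 then a' z.1 * w' z.2 else 0.
have mk : measurable_fun setT k.
  apply: measurable_fun_ifT.
  - apply: measurable_fun_ler.
    exact: measurable_snd.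
    exact: measurable_fst.
  - apply: measurable_funM.
      by apply: measurableT_comp => //; exact: measurable_fst.
    by apply: measurableT_comp => //; exact: measurable_snd.
  - exact: measurable_cst.
have mkE : measurable_fun setT (EFin \o k) by apply/measurable_EFinP.
have iw' : mu.-integrable setT (EFin \o w').
  rewrite /w' -restrict_EFin.
  exact: ((integrable_mkcond (mu := mu) (EFin \o w) mdom).1 iw).
have ia : mu.-integrable (dom R) (EFin \o a) by exact: integrable_bounded aC.
have ia' : mu.-integrable setT (EFin \o a').
  rewrite /a' -restrict_EFin.
  exact: ((integrable_mkcond (mu := mu) (EFin \o a) mdom).1 ia).
have ik : (mu \x mu)%E.-integrable setT (EFin \o k).
  apply/(integrable12ltyP mu mu mkE).
  apply: (@le_lt_trans _ _ (\int[mu]_x (`|(a' x)%:E| * \int[mu]_y `|(w' y)%:E|))%E).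
    apply: ge0_le_integral => //.
    - by move=> x _; exact: integral_ge0.
    - apply: (@measurable_fun_fubini_tonelli_F _ _ _ _ _ mu
        (fun z => `|(EFin \o k) z|%E)) => //.
      exact: measurableT_comp.
    - apply: emeasurable_funM; last exact: measurable_cst.
      by apply: measurableT_comp => //; exact/measurable_EFinP.
    - move=> x _; rewrite -ge0_integralZl//; last first.
        by apply: measurableT_comp => //; exact/measurable_EFinP.
      apply: ge0_le_integral => //.
      + apply: measurableT_comp => //.
        exact: (measurableT_comp mkE (measurable_pair1 x)).
      + by apply: measurable_funeM; apply: measurableT_comp => //; exact/measurable_EFinP.
      + move=> y _; rewrite /k /=; case: ifP => _; first by rewrite -EFinM normrM.
        by rewrite normr0 -EFinM lee_fin mulr_ge0.
  rewrite ge0_integralZr//; last 2 first.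
  - by apply: measurableT_comp => //; exact/measurable_EFinP.
  - exact: integral_ge0.
  apply: lte_mul_pinfty; first exact: integral_ge0.
    apply/fin_numPlt; rewrite (lt_le_trans (ltNyr 0))//=; last exact: integral_ge0.
    by case/integrableP : ia'.
  by case/integrableP : iw'.
have iAx x : dom R x -> mu.-integrable `[0, x]%classic (EFin \o w).
  move=> /domP/andP[x0 xpi]; apply: integrableS iw => // t /=.
  by rewrite in_itv/= => /andP[t0 tx]; apply/domP; rewrite t0 (le_trans tx).
have iBt t : dom R t -> mu.-integrable `[t, pi]%classic (EFin \o a).
  move=> /domP/andP[t0 tpi]; apply: integrableS ia => // x /=.
  by rewrite in_itv/= => /andP[tx xpi]; apply/domP; rewrite xpi (le_trans t0).
have pt : (point : R) = 0 by [].
have k_row x y : dom R x -> k (x, y) = a x * (w \_ `[0, x]) y.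
  move=> xd; rewrite /k /= /a' /w' !patchE (mem_set xd).
  move/domP : xd => /andP[x0 xpi].
  have -> : (y \in `[0, x]%classic) = (y <= x) && (y \in dom R).
    apply/idP/andP => [/set_mem|[yx /set_mem]] /=; rewrite ?in_itv/=.
      move=> /andP[y0 yx]; split; first exact: yx.
      by apply/mem_set/domP; rewrite y0 (le_trans yx).
    by move=> /domP/andP[y0 _]; apply/mem_set; rewrite /= in_itv/= y0.
  by case: (y <= x); rewrite /= ?pt ?mulr0.
have k_col x t : dom R t -> k (x, t) = w t * (a \_ `[t, pi]) x.
  move=> td; rewrite /k /= /a' /w' !patchE (mem_set td).
  move/domP : td => /andP[t0 tpi].
  have -> : (x \in `[t, pi]%classic) = (t <= x) && (x \in dom R).
    apply/idP/andP => [/set_mem|[tx /set_mem]] /=; rewrite ?in_itv/=.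
      move=> /andP[tx xpi]; split; first exact: tx.
      by apply/mem_set/domP; rewrite xpi (le_trans t0).
    by move=> /domP/andP[_ xpi]; apply/mem_set; rewrite /= in_itv/= tx.
  by case: (t <= x); case: (x \in dom R); rewrite /= ?pt ?mul0r ?mulr0 // mulrC.
have k_row0 x y : x \notin dom R -> k (x, y) = 0.
  by move=> /negbTE xd; rewrite /k /= /a' patchE xd pt mul0r; case: ifP.
have k_col0 x t : t \notin dom R -> k (x, t) = 0.
  by move=> /negbTE td; rewrite /k /= /w' patchE td pt mulr0; case: ifP.
have FB := Fubini ik.
rewrite /integral0pi [LHS]Rintegral_mkcond [RHS]Rintegral_mkcond [LHS]/Rintegral.
rewrite [RHS]/Rintegral; apply: (congr1 fine).
transitivity (\int[mu]_x \int[mu]_y (k (x, y))%:E)%E.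
  apply: eq_integral => x _; rewrite patchE; case: ifPn => [/set_mem xd|xd].
    have <- := integral_scaled_restrict (a x) (measurable_itv `[0, x]) (iAx x xd).
    by apply: eq_integral => y _; rewrite k_row.
  by rewrite integral0_eq // => y _; rewrite k_row0.
transitivity (\int[mu]_y \int[mu]_x (k (x, y))%:E)%E; first exact: FB.
apply: eq_integral => t _; rewrite patchE; case: ifPn => [/set_mem td|td].
  have <- := integral_scaled_restrict (w t) (measurable_itv `[t, pi]) (iBt t td).
  by apply: eq_integral => x _; rewrite k_col.
by rewrite integral0_eq // => x _; rewrite k_col0.
Qed.

Lemma continuous_of_derivative G G' :
  (forall x : R, is_derive x 1 G (G' x)) -> continuous G.
Proof. by move=> dG x; apply/differentiable_continuous/derivable1_diffP. Qed.

Lemma integral_derivative G G' (a b : R) : (forall x : R, is_derive x 1 G (G' x)) ->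
  continuous G' -> a <= b -> \int[mu]_(x in `[a, b]) G' x = G b - G a.
Proof.
move=> dG cG'; have cG := continuous_of_derivative dG.
rewrite le_eqVlt => /predU1P[->|ab].
  by rewrite set_itv1 Rintegral_set1 subrr.
rewrite /Rintegral (continuous_FTC2 (F := G) ab)//.
- exact: continuous_subspaceT.
- split; first by move=> x _; exact: ex_derive.
  + exact/cvg_at_right_filter/cG.
  + exact/cvg_at_left_filter/cG.
- by move=> x _; rewrite derive1E derive_val.
Qed.

(** The factor [v] has a derivative only in the weak sense, so that the
    product rule is unavailable; writing [v] and [G] as primitives turns the
    formula into the exchange of integrals over a triangle. *)
Lemma weak_integration_by_parts G G' v v' :
  (forall x : R, is_derive x 1 G (G' x)) -> continuous G' ->
  weak_derivative v v' ->
  integral0pi (fun x => G x * v' x) =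
    G pi * v pi - G 0 * v 0 - integral0pi (fun x => G' x * v x).
Proof.
move=> dG cG' wv; have [Lv' vE] := wv; have mdom := @measurable_dom R.
have iv' := L2_integrable Lv'.
have mG' : measurable_fun (dom R) G'.
  exact: measurable_funS (continuous_measurable_fun cG').
have cG := continuous_of_derivative dG.
have mG : measurable_fun (dom R) G.
  exact: measurable_funS (continuous_measurable_fun cG).
have bdd (h : R -> R) : continuous h -> exists C : R, forall x, dom R x -> `|h x| <= C.
  move=> ch.
  have [C [_ HC]] := compact_bounded (continuous_compact
    (continuous_subspaceT ch : {within dom R, continuous h}) (@segment_compact R 0 pi)).
  exists (C + 1) => x xd; apply: (HC (C + 1)); first by rewrite ltrDl.
  by exists x.
have [C' G'C] := bdd _ cG'; have [C GC] := bdd _ cG.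
have ftc t : dom R t -> \int[mu]_(x in `[t, pi]) G' x = G pi - G t.
  by move=> /domP/andP[_ tpi]; exact: integral_derivative dG cG' tpi.
have ftc0 : \int[mu]_(x in dom R) G' x = G pi - G 0.
  by apply: ftc; apply/domP; rewrite lexx pi_ge0.
have iG' : mu.-integrable (dom R) (EFin \o G').
  exact: integrable_bounded G'C.
pose P x := \int[mu]_(t in `[0, x]) v' t.
have fub := triangle_fubini mG' G'C iv'.
have Gv' : integral0pi (fun t => v' t * \int[mu]_(x in `[t, pi]) G' x) =
    G pi * (v pi - v 0) - integral0pi (fun x => G x * v' x).
  have -> : v pi - v 0 = integral0pi v'.
    have := vE pi; rewrite inE => ->; first by rewrite addrC addKr.
    by apply/domP; rewrite lexx pi_ge0.
  rewrite /integral0pi -(RintegralZl (mu := mu) (G pi) mdom iv').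
  rewrite -(RintegralB (mu := mu) mdom); last 2 first.
  - exact: (integrableZl (mu := mu) mdom (G pi) iv').
  - exact: integrable_bounded_mul mdom mG GC iv'.
  by apply: eq_Rintegral => t /set_mem td; rewrite (ftc t td); ring.
have G'v : integral0pi (fun x => G' x * v x) =
    v 0 * (G pi - G 0) + integral0pi (fun x => G' x * P x).
  have [mv [Cv vC]] := weak_derivative_cont_bounded wv.
  have iv : mu.-integrable (dom R) (EFin \o v) by exact: integrable_bounded vC.
  have i1 := integrable_bounded_mul mdom mG' G'C iv.
  have i2 : mu.-integrable (dom R) (EFin \o (fun x => v 0 * G' x)).
    exact: (integrableZl (mu := mu) mdom (v 0) iG').
  have i3 : mu.-integrable (dom R) (EFin \o (fun x => G' x * P x)).
    apply: eq_integrable (integrableB (mu := mu) mdom i1 i2); first exact: mdom.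
    by move=> t td; rewrite /= vE // /P -EFinB; congr EFin; ring.
  rewrite -ftc0 /integral0pi -(RintegralZl (mu := mu) (v 0) mdom iG').
  rewrite -(RintegralD (mu := mu) mdom i2 i3).
  by apply: eq_Rintegral => t td; rewrite vE // /P; ring.
rewrite G'v /P fub Gv'; ring.
Qed.

End TriangleFubini.

(** * Eigenfunctions given by their coefficients *)

Lemma cvg_abs_bounded_sum (R : realType) (a : nat -> R) (K : R) :
  (forall n, \sum_(j < n) `|a j| <= K) ->
  exists S : R, (fun n => \sum_(j < n) a j) @ \oo --> S.
Proof.
move=> aK; have [|||S cS _] := @tannery R nat \oo _ id (fun _ j => a j) a
  (fun j => `|a j|) K aK.
- by apply: nearW.
- by move=> j; exact: cvg_cst.
- exact: nbhs_infty_ge.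
- by exists S.
Qed.

(** The weak eigenvalue equation, reduced to numbers: [y] are the coefficients
    of the eigenfunction, [h] those of the test function. The square partial
    sums of y_l B_lj h_j converge to the potential term when they are summed
    over [j] first; summed over [l] first, they are evaluated by the
    eigenvalue equation for [y]. *)
Lemma weak_equation_coefficients (R : realType) (D : nat -> R)
    (B : nat -> nat -> R) (M K H t : R) (y h Q : nat -> R) (Y1 Y2 Y3 : R) :
  (forall l, 0 <= D l) ->
  (forall j l, B j l = B l j) ->
  (forall j n, \sum_(l < n) `|B j l| <= M) ->
  (forall L, \sum_(l < L) (1 + D l) * `|y l| <= K) ->
  (forall l, (fun n => \sum_(j < n) B l j * y j) @ \oo --> (t - D l) * y l) ->
  (forall l, `|h l| <= H) ->
  (forall l, (fun n => \sum_(j < n) B l j * h j) @ \oo --> Q l) ->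
  (fun n => \sum_(l < n) y l * (D l * h l)) @ \oo --> Y1 ->
  (fun n => \sum_(l < n) y l * Q l) @ \oo --> Y2 ->
  (fun n => \sum_(l < n) y l * h l) @ \oo --> Y3 ->
  Y1 + Y2 = t * Y3.
Proof.
move=> D0 Bs BM yK yB hH hQ cY1 cY2 cY3.
have H0 : 0 <= H by apply: le_trans (hH 0%N).
have M0 : 0 <= M by have := BM 0 0; rewrite big_ord0.
have K0 : 0 <= K by have := yK 0; rewrite big_ord0.
have B_le j l : `|B j l| <= M.
  apply: le_trans (BM j l.+1); rewrite big_ord_recr/= lerDr.
  exact: sumr_ge0.
have yK' L : \sum_(l < L) `|y l| <= K.
  apply: le_trans (yK L); apply: ler_sum => l _.
  by rewrite ler_peMl// lerDl.
pose sq n := \sum_(l < n) y l * \sum_(j < n) B l j * h j.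
have sqE n : sq n = \sum_(j < n) h j * \sum_(l < n) B j l * y l.
  rewrite /sq; under eq_bigr do rewrite mulr_sumr.
  rewrite exchange_big; apply: eq_bigr => j _; rewrite mulr_sumr.
  by apply: eq_bigr => l _; rewrite (Bs j l); ring.
have sq2 : sq @ \oo --> Y2.
  have b1 n : \sum_(j < n) `|y j| * (M * H) <= K * (M * H).
    by rewrite -mulr_suml ler_wpM2r// mulr_ge0.
  have b2 : \forall n \near \oo, forall l,
      `|y l * \sum_(j < n) B l j * h j| <= `|y l| * (M * H).
    apply: nearW => n l; rewrite normrM ler_wpM2l//.
    apply: le_trans (ler_wpM2r H0 (BM l n)); rewrite mulr_suml.
    apply: ler_norm_sum_dominated => j.
    by rewrite normrM ler_wpM2l.
  have b3 l : (fun n => y l * \sum_(j < n) B l j * h j) @ \oo --> y l * Q l.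
    by apply: cvgM; [exact: cvg_cst|exact: hQ].
  have [S cS sqS] := tannery _ (N := id) b1 b2 b3 nbhs_infty_ge.
  by have -> : Y2 = S by apply: (cvg_unique _ cY2 cS).
(* [beta j] = sum over l of |B_jl| |y_l| is the summable majorant for the
   second order of summation. *)
have ex_beta j : exists b : R, (fun n => \sum_(l < n) `|B j l| * `|y l|) @ \oo --> b.
  apply: (@cvg_abs_bounded_sum _ (fun l => `|B j l| * `|y l|) (M * K)) => n.
  apply: le_trans (ler_wpM2l M0 (yK' n)); rewrite mulr_sumr.
  by apply: ler_sum => l _; rewrite ger0_norm ?mulr_ge0// ler_wpM2r.
have [beta betaE] := choice ex_beta.
have beta_ge j n : \sum_(l < n) `|B j l| * `|y l| <= beta j.
  refine (cvgr_to_ge (betaE j) _); apply: filterS (nbhs_infty_ge n) => k nk.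
  rewrite -!(big_mkord xpredT (fun l => `|B j l| * `|y l|)).
  by rewrite (big_cat_nat _ nk)//= lerDl sumr_ge0// => l _; rewrite mulr_ge0.
have beta_sum n : \sum_(j < n) beta j <= M * K.
  have c : \sum_(j < n) \sum_(l < k) `|B j l| * `|y l| @[k --> \oo] -->
      \sum_(j < n) beta j by apply: cvg_sumr => j _; exact: betaE.
  apply: (cvgr_to_le c); apply: nearW => k; rewrite exchange_big.
  apply: le_trans (ler_wpM2l M0 (yK' k)); rewrite mulr_sumr.
  apply: ler_sum => l _; rewrite -mulr_suml ler_wpM2r//.
  by under eq_bigr do rewrite Bs.
have sq1 : sq @ \oo --> t * Y3 - Y1.
  rewrite (funext sqE).
  have b1 n : \sum_(j < n) H * beta j <= H * (M * K).
    by rewrite -mulr_sumr ler_wpM2l.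
  have b2 : \forall n \near \oo, forall j,
      `|h j * \sum_(l < n) B j l * y l| <= H * beta j.
    apply: nearW => n j; rewrite normrM; apply: ler_pM => //.
    apply: le_trans (beta_ge j n); apply: ler_norm_sum_dominated => l.
    by rewrite normrM.
  have b3 j : (fun n => h j * \sum_(l < n) B j l * y l) @ \oo -->
      h j * ((t - D j) * y j).
    by apply: cvgM; [exact: cvg_cst|exact: yB].
  have [S cS sqS] := tannery _ (N := id) b1 b2 b3 nbhs_infty_ge.
  have -> : t * Y3 - Y1 = S; last by [].
  have c : (fun n => t * (\sum_(l < n) y l * h l) - \sum_(l < n) y l * (D l * h l))
      @ \oo --> t * Y3 - Y1.
    by apply: cvgB => //; apply: cvgM => //; exact: cvg_cst.
  apply: (cvg_unique _ c); first exact: Rhausdorff.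
  rewrite (_ : (fun n => _) = fun n => \sum_(j < n) h j * ((t - D j) * y j))//.
  apply/funext => n; rewrite mulr_sumr -sumrB; apply: eq_bigr => j _; ring.
have : t * Y3 - Y1 = Y2 by apply: (cvg_unique _ sq1 sq2).
lra.
Qed.

Section CoefficientSeries.
Context {R : realType}.
Local Notation mu := (@lebesgue_measure R).
Variables (D y : nat -> R) (c K : R) (f : nat -> R -> R).
Hypothesis D_ge0 : forall l, 0 <= D l.
Hypothesis y_sum : forall L, \sum_(l < L) (1 + D l) * `|y l| <= K.
Hypothesis f_meas : forall l, measurable_fun (dom R) (f l).
Hypothesis f_bound : forall l x, dom R x -> `|f l x| <= c * (1 + D l).

Definition coef_series (f : nat -> R -> R) (y : nat -> R) (x : R) : R :=
  limn (fun n => \sum_(l < n) y l * f l x).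

Let c_ge0 : 0 <= c.
Proof.
have x0 : dom R 0 by apply/domP; rewrite lexx pi_ge0.
have := le_trans (normr_ge0 _) (f_bound 0 x0).
by rewrite pmulr_lge0// ltr_pwDl.
Qed.

Lemma coef_series_abs n x : dom R x -> \sum_(l < n) `|y l * f l x| <= c * K.
Proof.
move=> xd; apply: le_trans (ler_wpM2l c_ge0 (y_sum n)); rewrite mulr_sumr.
apply: ler_sum => l _; rewrite normrM mulrA mulrC ler_wpM2r//.
exact: f_bound.
Qed.

Lemma coef_series_partial_bound n x : dom R x ->
  `|\sum_(l < n) y l * f l x| <= c * K.
Proof. by move=> xd; apply: le_trans (coef_series_abs n xd); exact: ler_norm_sum. Qed.

Lemma coef_series_cvg x : dom R x ->
  (fun n => \sum_(l < n) y l * f l x) @ \oo --> coef_series f y x.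
Proof.
move=> xd; have [S cS] := @cvg_abs_bounded_sum R (fun l => y l * f l x) (c * K)
  (fun n => coef_series_abs n xd).
by rewrite /coef_series (cvg_lim _ cS).
Qed.

Lemma measurable_partial_sum A n : A `<=` dom R -> measurable A ->
  measurable_fun A (fun x => \sum_(l < n) y l * f l x).
Proof.
move=> Ad mA; apply: measurable_sum => l.
apply: measurable_funM; first exact: measurable_cst.
by apply: measurable_funS (f_meas l) => //; exact: measurable_dom.
Qed.

Lemma measurable_coef_series : measurable_fun (dom R) (coef_series f y).
Proof.
apply: (measurable_fun_cvg
  (fun n => measurable_partial_sum n (@subset_refl _ _) measurable_dom)).
by move=> x; exact: coef_series_cvg.
Qed.

Lemma coef_series_bound x : dom R x -> `|coef_series f y x| <= c * K.
Proof.
move=> xd; have cn : (fun n => `|\sum_(l < n) y l * f l x|) @ \oo --> `|coef_series f y x|.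
  by apply: cvg_norm; exact: coef_series_cvg.
by apply: (cvgr_to_le cn); apply: nearW => n; exact: coef_series_partial_bound.
Qed.

Lemma coef_series_integral A k : A `<=` dom R -> measurable A ->
  mu.-integrable A (EFin \o k) ->
  (fun n => \sum_(l < n) y l * \int[mu]_(x in A) (f l x * k x)) @ \oo -->
  \int[mu]_(x in A) (coef_series f y x * k x).
Proof.
move=> Ad mA ik.
have := bounded_convergence mA (fun n => measurable_partial_sum n Ad mA)
  (fun n x Ax => coef_series_partial_bound n (Ad x Ax))
  (fun x Ax => coef_series_cvg (Ad x Ax)) ik.
rewrite (_ : (fun n => _) = fun n => \sum_(l < n) y l * \int[mu]_(x in A) (f l x * k x))//.
apply/funext => n.
have ifk l : mu.-integrable A (EFin \o (fun x => f l x * k x)).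
  apply: (integrable_bounded_mul (C := c * (1 + D l))) => //.
    by apply: measurable_funS (f_meas l) => //; exact: measurable_dom.
  by move=> x Ax; exact/f_bound/Ad.
elim: n => [|n IH].
  rewrite big_ord0; under eq_Rintegral do rewrite big_ord0 mul0r.
  by rewrite Rintegral_cst// mul0r.
rewrite big_ord_recr/= -IH -RintegralZl// -RintegralD//.
- by apply: eq_Rintegral => x _; rewrite big_ord_recr/= mulrDl mulrA.
- apply: (integrable_bounded_mul (C := c * K)) => //.
    exact: measurable_partial_sum.
  by move=> x Ax; exact/coef_series_partial_bound/Ad.
- exact: (integrableZl (mu := mu) mA (y n) (ifk n)).
Qed.

End CoefficientSeries.

(** The interface between the variational principle and its two instances, the
    cosine and the sine basis: [D] lists the free eigenvalues and [B] is the
    matrix of multiplication by [q]. By [gb_domain], membership in the form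
    domain follows from vanishing at the common zeros of the basis functions:
    the two end points for sines, no point for cosines. *)
Record galerkin_basis (R : realType) (q : R -> R) (V : set (R -> R))
    (f g : nat -> R -> R) (D : nat -> R) (B : nat -> nat -> R) (c M : R) : Prop := {
  gb_D_ge0 : forall l, 0 <= D l;
  gb_D_growth : forall l, l.+1%:R ^+ 2 <= 2 * (D l + 1);
  gb_B_sym : forall j l, B j l = B l j;
  gb_B_rows : forall j n, \sum_(l < n) `|B j l| <= M;
  gb_q_meas : measurable_fun (dom R) q;
  gb_q_bound : exists C : R, forall x, dom R x -> `|q x| <= C;
  gb_f_meas : forall l, measurable_fun (dom R) (f l);
  gb_g_meas : forall l, measurable_fun (dom R) (g l);
  gb_f_bound : forall l x, dom R x -> `|f l x| <= c;
  gb_g_bound : forall l x, dom R x -> `|g l x| <= c * (1 + D l);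
  gb_primitive : forall l x, dom R x ->
    f l x = f l 0 + \int[@lebesgue_measure R]_(t in `[0, x]) g l t;
  gb_weak : forall l v v', V v -> weak_derivative v v' ->
    integral0pi (fun x => g l x * v' x) = D l * integral0pi (fun x => f l x * v x);
  gb_ortho : forall j l, integral0pi (fun x => f j x * f l x) = (j == l)%:R;
  gb_potential : forall j x, dom R x ->
    (fun n => \sum_(l < n) B j l * f l x) @ \oo --> q x * f j x;
  gb_domain : forall u, H1 R u ->
    (forall x, dom R x -> (forall l, f l x = 0) -> u x = 0) -> V u }.

Section Eigenfunctions.
Context {R : realType} (q : R -> R) (V : set (R -> R)) (f g : nat -> R -> R).
Context (D : nat -> R) (B : nat -> nat -> R) (c M : R).
Hypothesis gb : galerkin_basis q V f g D B c M.
Local Notation mu := (@lebesgue_measure R).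

Let c_ge0 : 0 <= c.
Proof.
have x0 : dom R 0 by apply/domP; rewrite lexx pi_ge0.
exact: le_trans (normr_ge0 _) (gb_f_bound gb 0 x0).
Qed.

Let f_bound' l x : dom R x -> `|f l x| <= c * (1 + D l).
Proof.
move=> xd; apply: le_trans (gb_f_bound gb l xd) _.
by rewrite ler_peMr// lerDl (gb_D_ge0 gb).
Qed.

Section OneSeries.
Variables (y : nat -> R) (K : R).
Hypothesis y_sum : forall L, \sum_(l < L) (1 + D l) * `|y l| <= K.

Lemma coef_series_weak_derivative :
  weak_derivative (coef_series f y) (coef_series g y).
Proof.
have D0 := gb_D_ge0 gb; have mdom := @measurable_dom R.
have mg := measurable_coef_series D0 y_sum (gb_g_meas gb) (gb_g_bound gb).
have bg := coef_series_bound D0 y_sum (gb_g_bound gb).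
split.
  split=> //; apply: (@integrable_bounded R _ (fun x => coef_series g y x ^+ 2)
    ((c * K) ^+ 2)) => //; first exact: measurable_funX.
  move=> x xd; have cK : 0 <= c * K by apply: le_trans (bg x xd).
  by rewrite normrX ler_pXn2r ?nnegrE//; exact: bg.
move=> x /set_mem xd; have /domP/andP[x0 xpi] := xd.
have d0 : dom R 0 by apply/domP; rewrite lexx pi_ge0.
have Ad : `[0, x]%classic `<=` dom R.
  by move=> t /=; rewrite in_itv/= => /andP[t0 tx]; apply/domP; rewrite t0 (le_trans tx).
have mA : measurable (`[0, x]%classic : set R) by exact: measurable_itv.
have i1 : mu.-integrable `[0, x]%classic (EFin \o cst (1 : R)).
  by apply: (@integrable_bounded _ _ _ 1) => // t _; rewrite normr1.
have cx := coef_series_cvg D0 y_sum f_bound' xd.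
have c0 := coef_series_cvg D0 y_sum f_bound' d0.
have cg := coef_series_integral D0 y_sum (gb_g_meas gb) (gb_g_bound gb) Ad mA i1.
have cx' : (fun n => \sum_(l < n) y l * f l x) @ \oo -->
    coef_series f y 0 + \int[mu]_(t in `[0, x]) (coef_series g y t * cst 1 t).
  rewrite (_ : (fun n => _) = fun n => \sum_(l < n) y l * f l 0 +
      \sum_(l < n) y l * \int[mu]_(t in `[0, x]) (g l t * cst 1 t)).
    by apply: cvgD.
  apply/funext => n; rewrite -big_split; apply: eq_bigr => l _ /=.
  rewrite (gb_primitive gb l xd) mulrDr; congr (_ + _ * _).
  by apply: eq_Rintegral => t _; rewrite mulr1.
have -> : coef_series f y x =
    coef_series f y 0 + \int[mu]_(t in `[0, x]) (coef_series g y t * cst 1 t).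
  by apply: (cvg_unique _ cx cx').
congr (_ + _).
by apply: eq_Rintegral => t _; rewrite mulr1.
Qed.

(** Orthonormality recovers the coefficients; eigenfunctions with independent
    coefficient sequences are therefore independent. *)
Lemma coef_series_coef l : integral0pi (fun x => coef_series f y x * f l x) = y l.
Proof.
have il : mu.-integrable (dom R) (EFin \o f l).
  apply: (integrable_bounded (C := c)) => //; first exact: measurable_dom.
    exact: gb_f_meas gb l.
  exact: gb_f_bound gb l.
have := coef_series_integral (gb_D_ge0 gb) y_sum (gb_f_meas gb) f_bound'
  (@subset_refl _ _) (@measurable_dom R) il.
move=> c1; apply: (cvg_unique _ c1); first exact: Rhausdorff.
apply: cvg_near_cst; apply: filterS (nbhs_infty_gt l) => n ln /=.
have ortho j : \int[mu]_(x in dom R) (f j x * f l x) = (j == l)%:R.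
  exact: gb_ortho gb j l.
rewrite (bigD1 (Ordinal ln))//= ortho eqxx mulr1 big1 ?addr0// => j jl.
by rewrite ortho (_ : (nat_of_ord j == l) = false) ?mulr0//; exact: negbTE.
Qed.

Lemma coef_series_eigenfunction t :
  (forall l, (fun n => \sum_(j < n) B l j * y j) @ \oo --> (t - D l) * y l) ->
  weak_eigenspace q V t (coef_series f y).
Proof.
move=> yB; have ws := coef_series_weak_derivative.
have D0 := gb_D_ge0 gb; have mdom := @measurable_dom R.
split.
  apply: (gb_domain gb); first by exists (coef_series g y).
  move=> x xd fx; rewrite /coef_series.
  rewrite (_ : (fun n => _) = cst 0) ?lim_cst//.
  by apply/funext => n; rewrite big1// => l _; rewrite fx mulr0.
move=> v u' v' Vv wu wv.
have [mv [Cv vC]] := weak_derivative_cont_bounded wv.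
have mv' : measurable_fun (dom R) v' by case: wv => -[].
rewrite (weak_derivative_unique wu ws mv').
have iv' : mu.-integrable (dom R) (EFin \o v') by apply: L2_integrable; case: wv.
have iv : mu.-integrable (dom R) (EFin \o v) by exact: integrable_bounded vC.
have [Cq qC] := gb_q_bound gb.
have iqv : mu.-integrable (dom R) (EFin \o (fun x => q x * v x)).
  exact: integrable_bounded_mul (gb_q_meas gb) qC iv.
have sub := @subset_refl _ (dom R).
have c1 := coef_series_integral D0 y_sum (gb_g_meas gb) (gb_g_bound gb) sub mdom iv'.
have c2 := coef_series_integral D0 y_sum (gb_f_meas gb) f_bound' sub mdom iqv.
have c3 := coef_series_integral D0 y_sum (gb_f_meas gb) f_bound' sub mdom iv.
pose h l := integral0pi (fun x => f l x * v x).
have hH l : `|h l| <= c * Cv * pi.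
  have ifv : mu.-integrable (dom R) (EFin \o (fun x => f l x * v x)).
    exact: integrable_bounded_mul (gb_f_meas gb l) (gb_f_bound gb l) iv.
  rewrite /h /integral0pi; apply: le_trans (le_normr_Rintegral (mu := mu) mdom ifv) _.
  have -> : c * Cv * pi = \int[mu]_(x in dom R) (c * Cv).
    have mud : mu (dom R) = pi%:E.
      by rewrite /dom lebesgue_measure_itv/= lte_fin pi_gt0 -EFinB subr0.
    by rewrite (Rintegral_cst mu mdom); congr (_ * _); exact: (congr1 fine (esym mud)).
  apply: le_Rintegral => //.
  - exact: integrable_norm.
  - by apply: (integrable_bounded (C := `|c * Cv|)).
  - by move=> x xd; rewrite normrM ler_pM//; [exact: gb_f_bound gb l x xd|exact: vC].
(* The coefficients of [q * f l] are row [l] of [B]: this is the expansion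
   of [q * f l] integrated against [v]. *)
have hQ l : (fun n => \sum_(j < n) B l j * h j) @ \oo -->
    integral0pi (fun x => f l x * (q x * v x)).
  have By L : \sum_(j < L) (1 + 0) * `|B l j| <= M.
    by under eq_bigr do rewrite addr0 mul1r; exact: gb_B_rows gb l L.
  have fb j x : dom R x -> `|f j x| <= c * (1 + 0).
    by rewrite addr0 mulr1; exact: gb_f_bound gb j x.
  have := coef_series_integral (D := fun=> 0) (fun=> lexx 0) By (gb_f_meas gb) fb
    sub mdom iv.
  rewrite (_ : \int[mu]_(x in dom R) (coef_series f (B l) x * v x) =
    integral0pi (fun x => f l x * (q x * v x)))//.
  apply: eq_Rintegral => x /set_mem xd.
  rewrite /coef_series (cvg_lim _ (gb_potential gb (j := l) xd)); last exact: Rhausdorff.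
  ring.
have c1' : (fun n => \sum_(l < n) y l * (D l * h l)) @ \oo -->
    integral0pi (fun x => coef_series g y x * v' x).
  rewrite (_ : (fun n => _) = fun n => \sum_(l < n) y l *
    \int[mu]_(x in dom R) (g l x * v' x)) //.
  by apply/funext => n; apply: eq_bigr => l _; rewrite -(gb_weak gb l Vv wv).
have := weak_equation_coefficients D0 (gb_B_sym gb) (gb_B_rows gb) y_sum yB hH hQ
  c1' c2 c3.
rewrite /integral0pi => <-; congr (_ + _).
by apply: eq_Rintegral => x _; ring.
Qed.

End OneSeries.

End Eigenfunctions.

(** * Comparison with a given list of eigenvalues *)

(** More vectors than dimensions leave a nonzero row vector that annihilates
    the matrix of coefficients. *)
Lemma independent_family_le_dim (R : realType) (E : set (R -> R)) (m p : nat)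
    (w : 'I_p -> R -> R) : has_dim E m -> (forall i, E (w i)) ->
  (forall a : 'I_p -> R,
    (forall x, dom R x -> \sum_(i < p) a i * w i x = 0) -> forall i, a i = 0) ->
  (p <= m)%N.
Proof.
move=> [e [_ _ Espan]] Ew wfree.
have [C CE] := choice (fun i => Espan (w i) (Ew i)).
pose A : 'M[R]_(p, m) := \matrix_(i, j) C i j.
rewrite leqNgt; apply/negP => mp.
have K0 : kermx A != 0.
  rewrite -mxrank_eq0 mxrank_ker -lt0n subn_gt0.
  exact: leq_ltn_trans (rank_leq_col A) mp.
move: K0; rewrite -nz_row_eq0 => /eqP; apply.
have /sub_kermxP rA := nz_row_sub (kermx A).
move: rA; set r := nz_row _ => rA.
apply/rowP => i; rewrite mxE; move: i.
apply: (wfree (fun i => r 0 i)) => x xd.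
have -> : \sum_(i < p) r 0 i * w i x = \sum_(j < m) (r *m A) 0 j * e j x.
  under eq_bigr => i _ do rewrite (CE i x (mem_set xd)) mulr_sumr.
  rewrite exchange_big; apply: eq_bigr => j _; rewrite mxE mulr_suml.
  by apply: eq_bigr => i _; rewrite mxE mulrA.
by rewrite rA big1// => j _; rewrite mxE mul0r.
Qed.

Lemma card_eq_seq_le (A : set nat) (n : nat) (s : seq nat) :
  (A #= `I_n)%card -> (forall i, A i -> i \in s) -> (n <= size s)%N.
Proof.
move=> An As; rewrite -card_le_II.
have /card_eqPle[_ h1] := An.
apply: (card_le_trans h1); apply: card_le_trans (card_image_le (nth 0%N s) `I_(size s)).
apply: subset_card_le => i Ai; exists (index i s).
  by rewrite /= index_mem As.
by rewrite nth_index ?As.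
Qed.

(** If [alpha k < nu k], the [k + 1] independent eigenfunctions up to index
    [k] have eigenvalues below [nu k]. Only [k] of the [nu] lie there, although
    each value occurs among the [nu] as often as its eigenspace has
    dimensions. *)
Lemma eigenvalue_le_of_eigenfunctions (R : realType) (q : R -> R) (V : set (R -> R))
    (nu alpha : nat -> R) (m : nat) (w : nat -> R -> R) :
  eigenvalue_sequence q V nu ->
  (forall i j, (i <= j < m)%N -> alpha i <= alpha j) ->
  (forall i, (i < m)%N -> weak_eigenspace q V (alpha i) (w i)) ->
  (forall a : nat -> R,
    (forall x, dom R x -> \sum_(i < m) a i * w i x = 0) ->
    forall i, (i < m)%N -> a i = 0) ->
  forall k, (k < m)%N -> nu k <= alpha k.
Proof.
move=> [numono nudim] als wE wfree k km; rewrite leNgt; apply/negP => nuk.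
pose sa := [seq alpha j | j <- iota 0 k.+1]; pose sb := [seq nu j | j <- iota 0 k].
(* It suffices to compare multiplicities: then [sa] is a permutation of a
   subsequence of the shorter list [sb]. *)
suff /count_subseqP[s sub /perm_size eqs] : forall t, (count_mem t sa <= count_mem t sb)%N.
  have := size_subseq sub; rewrite -eqs !size_map !size_iota.
  by rewrite ltnn.
move=> t; rewrite !count_map.
have [tsa|] := boolP (t \in sa); last first.
  by move=> tsa; rewrite -count_map (count_memPn tsa).
have tk : t < nu k.
  have /mapP[j] := tsa; rewrite mem_iota add0n ltnS => /= jk ->.
  by apply: le_lt_trans nuk; apply: als; rewrite jk.
have [mt dimt cardt] := nudim t.
apply: (@leq_trans mt); last first.
  rewrite -size_filter; apply: (card_eq_seq_le cardt) => i /= nui.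
  rewrite mem_filter /= nui eqxx mem_iota add0n ltnNge; apply/negP => ki.
  by move: tk; rewrite -nui ltNge numono.
rewrite -size_filter; set J := seq.filter _ _.
have Jm j : j \in J -> (j < m)%N /\ alpha j = t.
  rewrite mem_filter mem_iota add0n ltnS => /and3P[/eqP jt _ jk].
  by split => //; exact: leq_ltn_trans km.
have Ju : uniq J by rewrite filter_uniq// iota_uniq.
apply: (independent_family_le_dim (w := fun i : 'I_(size J) => w (nth 0%N J i)) dimt).
  move=> i; have [jm <-] := Jm _ (mem_nth 0%N (ltn_ord i)).
  exact: wE.
move=> a a0 i.
pose b j := if j \in J then (if insub (index j J) is Some i then a i else 0) else 0.
have bE (i' : 'I_(size J)) : b (nth 0%N J i') = a i'.
  by rewrite /b mem_nth// index_uniq// valK.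
have [jm _] := Jm _ (mem_nth 0%N (ltn_ord i)).
rewrite -bE; apply: wfree jm => x xd; rewrite -[RHS](a0 x xd).
transitivity (\sum_(j <- J) b j * w j x).
  rewrite -(big_mkord xpredT (fun j => b j * w j x)) (bigID (fun j => j \in J))/=.
  rewrite [X in _ + X]big1 ?addr0; last first.
    by move=> j /negbTE jJ; rewrite /b jJ mul0r.
  rewrite -big_filter. apply: perm_big; apply: uniq_perm => //.
    by rewrite filter_uniq// iota_uniq.
  move=> j; rewrite mem_filter mem_index_iota /=.
  by apply/andb_idr => /Jm[].
rewrite (big_nth 0%N) big_mkord; apply: eq_bigr => i' _.
by rewrite bE.
Qed.

(** The variational principle for a list known only through multiplicities: the
    eigenvalues built from the basis satisfy the trace inequality and dominate
    the list term by term. *)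
Lemma eigenvalue_sum_le_trace (R : realType) (q : R -> R) (V : set (R -> R))
    (f g : nat -> R -> R) (D : nat -> R) (B : nat -> nat -> R) (c M : R)
    (nu : nat -> R) (m N : nat) (phi : nat -> nat -> R) :
  galerkin_basis q V f g D B c M -> eigenvalue_sequence q V nu ->
  (forall i k, (i < m)%N -> (k < m)%N ->
     \sum_(l < N) phi i l * phi k l = (i == k)%:R) ->
  \sum_(i < m) nu i <= \sum_(i < m) schrodinger_form D B N (phi i).
Proof.
move=> gb hnu phio.
have [alpha [v [K [als vK vB vo vtr]]]] := variational_eigenvectors (gb_D_ge0 gb)
  (gb_D_growth gb) (gb_B_sym gb) (gb_B_rows gb) m.
apply: le_trans (vtr N phi phio); apply: ler_sum => i _.
apply: (eigenvalue_le_of_eigenfunctions hnu als (w := fun i => coef_series f (v i))) => //.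
  move=> k km; apply: (coef_series_eigenfunction gb (fun L => vK k L km)) => l.
  exact: vB.
move=> a a0 k km.
pose y l := \sum_(j < m) a j * v j l.
have yK L : \sum_(l < L) (1 + D l) * `|y l| <= \sum_(j < m) `|a j| * K.
  apply: (@le_trans _ _ (\sum_(l < L) \sum_(j < m) `|a j| * ((1 + D l) * `|v j l|))).
    apply: ler_sum => l _.
    have -> : \sum_(j < m) `|a j| * ((1 + D l) * `|v j l|) =
        (1 + D l) * \sum_(j < m) `|a j * v j l|.
      by rewrite mulr_sumr; apply: eq_bigr => j _; rewrite normrM mulrCA.
    by rewrite ler_wpM2l ?addr_ge0 ?(gb_D_ge0 gb)// ler_norm_sum.
  rewrite exchange_big; apply: ler_sum => j _; rewrite -mulr_sumr.
  by rewrite ler_wpM2l// vK.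
have y0 l : y l = 0.
  rewrite -(coef_series_coef gb yK) /integral0pi.
  rewrite (@eq_Rintegral _ _ _ _ _ (cst 0)).
    by rewrite Rintegral_cst ?mul0r//; exact: measurable_dom.
  move=> x /set_mem xd; rewrite -[RHS](mul0r (f l x)) -(a0 x xd); congr (_ * _).
  apply: cvg_lim; first exact: Rhausdorff.
  rewrite (_ : (fun n => _) = fun n => \sum_(j < m) a j * \sum_(i < n) v j i * f i x).
    apply: cvg_sumr => j _; apply: cvgM; first exact: cvg_cst.
    apply: (coef_series_cvg (gb_D_ge0 gb) (c := c) (fun L => vK j L (ltn_ord j))) xd.
    move=> i' x' xd'; apply: le_trans (gb_f_bound gb i' xd') _.
    rewrite ler_peMr ?lerDl ?(gb_D_ge0 gb)//.
    exact: le_trans (gb_f_bound gb i' xd').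
  apply/funext => n; rewrite /y; under eq_bigr do rewrite mulr_suml.
  rewrite exchange_big; apply: eq_bigr => j _; rewrite mulr_sumr.
  by apply: eq_bigr => i' _; rewrite mulrA.
have c0 : (fun n => \sum_(j < m) a j * \sum_(l < n) v j l * v k l) @ \oo -->
    \sum_(j < m) a j * (j == k :> nat)%:R.
  by apply: cvg_sumr => j _; apply: cvgM; [exact: cvg_cst|exact: vo].
have <- : \sum_(j < m) a j * (j == k :> nat)%:R = a k.
  rewrite (bigD1 (Ordinal km))//= eqxx mulr1 big1 ?addr0// => j jk.
  by rewrite (_ : (nat_of_ord j == k) = false) ?mulr0//; exact: negbTE.
apply: (cvg_unique _ c0); first exact: Rhausdorff.
rewrite (_ : (fun n => _) = cst 0); first exact: cvg_cst.
apply/funext => n; rewrite (_ : \sum_(j < m) _ = \sum_(l < n) y l * v k l).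
  by rewrite big1// => l _; rewrite y0 mul0r.
rewrite /y; under [RHS]eq_bigr do rewrite mulr_suml.
rewrite [RHS]exchange_big; apply: eq_bigr => j _; rewrite mulr_sumr.
by apply: eq_bigr => l _; rewrite mulrA.
Qed.

(** * Multiplication by the potential *)

Section CosineExpansion.
Context {R : realType} (q : R -> R).
Hypothesis hq : abs_cvg_cosine_expansion q.

(** The zeroth coefficient is halved, so that [q] is the plain sum of the
    [expansion_coef k * cos (k x)]. *)
Definition expansion_coef (k : nat) : R :=
  if k is 0 then cos_coef q 0 / 2 else cos_coef q k.

Lemma expansion_coef_summable : exists S, forall n, \sum_(k < n) `|expansion_coef k| <= S.
Proof.
have [cq _] := hq; exists (limn (series (fun k => `|cos_coef q k|))) => n.
have nd : nondecreasing_seq (series (fun k => `|cos_coef q k|)).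
  by apply/nondecreasing_seqP => k; rewrite /series/= big_nat_recr//= lerDl.
apply: le_trans (nondecreasing_cvgn_le nd cq n).
rewrite /series/= big_mkord; apply: ler_sum => -[[|k] kn] _ //=.
rewrite normrM ler_piMr// ger0_norm ?invr_ge0// invf_le1//.
by rewrite ler1n.
Qed.

Lemma expansion_cvg x : dom R x ->
  (fun n => \sum_(k < n) expansion_coef k * cos (k%:R * x)) @ \oo --> q x.
Proof.
move=> xd; have [_ /(_ x (mem_set xd))] := hq.
apply: cvg_trans; apply: near_eq_cvg; apply: filterS (nbhs_infty_gt 0) => n n0.
rewrite -(big_mkord xpredT (fun k => expansion_coef k * cos (k%:R * x))).
rewrite (big_ltn n0) mul0r cos0 mulr1; congr (_ + _).
by apply: eq_big_nat => -[].
Qed.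

Lemma mean_expansion_coef : mean q = expansion_coef 0.
Proof.
rewrite /mean /expansion_coef /cos_coef mulrAC.
rewrite [X in _ = X * _](_ : _ = pi^-1); last by rewrite mulrAC divff ?mul1r// pnatr_eq0.
congr (_ * _); apply: eq_Rintegral => x _.
by rewrite mul0r cos0 mulr1.
Qed.

Lemma potential_measurable : measurable_fun (dom R) q.
Proof.
apply: (@measurable_fun_cvg _ R R (dom R)
  (fun n x => \sum_(k < n) expansion_coef k * cos (k%:R * x)) q).
  move=> n; apply: measurable_sum => k; apply: measurable_funM; first exact: measurable_cst.
  apply: measurable_funS (continuous_measurable_fun _) => //.
  move=> x; apply: continuous_comp; last exact: continuous_cos.
  by apply: cvgM; [exact: cvg_cst|exact: cvg_id].
by move=> x; exact: expansion_cvg.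
Qed.

Lemma normr_cos_le1 (x : R) : `|cos x| <= 1.
Proof. by rewrite ler_norml cos_geN1 cos_le1. Qed.

Lemma normr_sin_le1 (x : R) : `|sin x| <= 1.
Proof. by rewrite ler_norml sin_geN1 sin_le1. Qed.

Lemma potential_bounded : exists C : R, forall x, dom R x -> `|q x| <= C.
Proof.
have [S HS] := expansion_coef_summable; exists S => x xd.
have c : (fun n => `|\sum_(k < n) expansion_coef k * cos (k%:R * x)|) @ \oo --> `|q x|.
  by apply: cvg_norm; exact: expansion_cvg.
apply: (cvgr_to_le c); apply: nearW => n; apply: le_trans (HS n).
apply: ler_norm_sum_dominated => k; rewrite normrM ler_piMr//.
exact: normr_cos_le1.
Qed.

(** The matrix of multiplication by [q] is assembled from the matrices [b k] of
    multiplication by [cos (k x)], which have finitely supported rows. *)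
Section MultiplicationMatrix.
Variables (b : nat -> nat -> nat -> R) (f : nat -> R -> R) (c : R).
Hypothesis b_sym : forall k j l, b k j l = b k l j.
Hypothesis b_rows : forall k j n, \sum_(l < n) `|b k j l| <= 3.
Hypothesis b_far : forall k j l, (j + l + 2 < k)%N -> b k j l = 0.
Hypothesis b_mul : forall k j N x, (j + k < N)%N ->
  \sum_(l < N) b k j l * f l x = cos (k%:R * x) * f j x.
Hypothesis f_bound : forall l x, dom R x -> `|f l x| <= c.

Definition multiplication_matrix (j l : nat) : R :=
  \sum_(k < j + l + 3) expansion_coef k * b k j l.

Lemma multiplication_matrix_widen j l n : (j + l + 3 <= n)%N ->
  multiplication_matrix j l = \sum_(k < n) expansion_coef k * b k j l.
Proof.
move=> h; rewrite (sum_ord_widen h (F := fun k => expansion_coef k * b k j l))//.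
by move=> k hk; rewrite b_far ?mulr0// (leq_trans _ hk)// addn3 addn2.
Qed.

Lemma multiplication_matrix_sym j l :
  multiplication_matrix j l = multiplication_matrix l j.
Proof. by rewrite /multiplication_matrix (addnC j); apply: eq_bigr => k _; rewrite b_sym. Qed.

Lemma multiplication_matrix_rows (S : R) :
  (forall n, \sum_(k < n) `|expansion_coef k| <= S) ->
  forall j n, \sum_(l < n) `|multiplication_matrix j l| <= S * 3.
Proof.
move=> HS j n; apply: (@le_trans _ _
  (\sum_(l < n) \sum_(k < j + n + 3) `|expansion_coef k| * `|b k j l|)).
  apply: ler_sum => l _; rewrite (@multiplication_matrix_widen _ _ (j + n + 3)).
    by apply: ler_norm_sum_dominated => k; rewrite normrM.
  by rewrite leq_add2r leq_add2l ltnW.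
rewrite exchange_big; apply: le_trans (ler_wpM2r _ (HS (j + n + 3)%N)) => //.
rewrite mulr_suml; apply: ler_sum => k _; rewrite -mulr_sumr.
by rewrite ler_wpM2l.
Qed.

Lemma multiplication_matrix_cvg j x : dom R x ->
  (fun n => \sum_(l < n) multiplication_matrix j l * f l x) @ \oo --> q x * f j x.
Proof.
move=> xd; have [S HS] := expansion_coef_summable.
have c0 : 0 <= c by apply: le_trans (f_bound 0 xd).
have E n : \sum_(l < n) multiplication_matrix j l * f l x =
    \sum_(k < j + n + 3) expansion_coef k * \sum_(l < n) b k j l * f l x.
  rewrite (eq_bigr (fun l : 'I_n =>
      \sum_(k < j + n + 3) expansion_coef k * (b k j l * f l x))).
    by rewrite exchange_big; apply: eq_bigr => k _; rewrite mulr_sumr.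
  move=> l _; rewrite (@multiplication_matrix_widen _ _ (j + n + 3)).
    by rewrite mulr_suml; apply: eq_bigr => k _; rewrite mulrA.
  by rewrite leq_add2r leq_add2l ltnW.
rewrite (funext E).
have b1 n : \sum_(k < n) `|expansion_coef k| * (3 * c) <= S * (3 * c).
  by rewrite -mulr_suml ler_wpM2r// mulr_ge0.
have b2 : \forall n \near \oo, forall k,
    `|expansion_coef k * \sum_(l < n) b k j l * f l x| <= `|expansion_coef k| * (3 * c).
  apply: nearW => n k; rewrite normrM ler_wpM2l//.
  apply: le_trans (ler_wpM2r c0 (b_rows k j n)); rewrite mulr_suml.
  by apply: ler_norm_sum_dominated => l; rewrite normrM ler_wpM2l// f_bound.
have b3 k : (fun n => expansion_coef k * \sum_(l < n) b k j l * f l x) @ \oo -->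
    expansion_coef k * cos (k%:R * x) * f j x.
  apply: cvg_near_cst; apply: filterS (nbhs_infty_gt (j + k)) => n jkn.
  by rewrite b_mul// mulrA.
have b4 n : \forall N \near \oo, (n <= j + N + 3)%N.
  apply: filterS (nbhs_infty_ge n) => N nN.
  by rewrite -addnA (leq_trans nN)// addnCA leq_addr.
have [T cT TE] := tannery _ (N := fun n => (j + n + 3)%N) b1 b2 b3 b4.
have -> : q x * f j x = T; last by [].
have cq : (fun n => (\sum_(k < n) expansion_coef k * cos (k%:R * x)) * f j x) @ \oo -->
    q x * f j x by apply: cvgM; [exact: expansion_cvg|exact: cvg_cst].
apply: (cvg_unique _ cq); first exact: Rhausdorff.
rewrite (_ : (fun n => _) = fun n => \sum_(k < n) expansion_coef k * cos (k%:R * x) * f j x)//.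
by apply/funext => n; rewrite mulr_suml.
Qed.

End MultiplicationMatrix.
End CosineExpansion.

(** * Trigonometric integrals *)

Section Trigonometry.
Context {R : realType}.
Implicit Types (a b x : R).

Lemma mul_cos_cos a b : cos a * cos b = (cos (a + b) + cos (a - b)) / 2.
Proof. by rewrite !cosD cosN sinN; field. Qed.

Lemma mul_sin_sin a b : sin a * sin b = (cos (a - b) - cos (a + b)) / 2.
Proof. by rewrite !cosD cosN sinN; field. Qed.

Lemma mul_cos_sin a b : cos a * sin b = (sin (b + a) + sin (b - a)) / 2.
Proof. by rewrite !sinD cosN sinN; field. Qed.

Lemma sin_nat_pi n : sin (n%:R * pi) = 0 :> R.
Proof.
elim: n => [|n IH]; first by rewrite mul0r sin0.
by rewrite -natr1 mulrDl mul1r sinDpi IH oppr0.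
Qed.

Lemma cos_natB j l x : (l <= j)%N -> cos ((j - l)%:R * x) = cos (j%:R * x - l%:R * x).
Proof. by move=> lj; rewrite natrB// mulrBl. Qed.

Lemma is_derive_dilation (h h' : R -> R) (C a x : R) :
  (forall y : R, is_derive y 1 h (h' y)) ->
  is_derive x 1 (fun x => C * h (a * x)) (C * a * h' (a * x)).
Proof.
move=> dh.
have da : is_derive x 1 (fun y : R => a * y) a.
  have := @is_deriveZ R R R id a x 1 1 (is_derive_id x 1).
  by rewrite /GRing.scale /= mulr1.
have := @is_deriveZ R R R _ C x 1 _ (@is_derive1_comp R h (fun y => a * y) x _ _ (dh _) da).
by rewrite /GRing.scale /= [h' _ * a]mulrC mulrA.
Qed.

Lemma continuous_dilation (h : R -> R) (C a : R) : continuous h ->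
  continuous (fun x => C * h (a * x)).
Proof.
move=> ch x; apply: cvgM; first exact: cvg_cst.
apply: (@continuous_comp _ _ _ (fun y : R => a * y) h); last exact: ch.
by apply: cvgM; [exact: cvg_cst|exact: cvg_id].
Qed.

Lemma measurable_continuous_dom (h : R -> R) : continuous h ->
  measurable_fun (dom R) h.
Proof. by move=> ch; exact: measurable_funS (continuous_measurable_fun ch). Qed.

Lemma integrable_continuous_dom (h : R -> R) : continuous h ->
  (@lebesgue_measure R).-integrable (dom R) (EFin \o h).
Proof.
move=> ch; apply: continuous_compact_integrable; first exact: segment_compact.
exact: continuous_subspaceT.
Qed.

Lemma continuous_cos_nat k : continuous (fun x : R => cos (k%:R * x)).
Proof.
move=> x; apply: (@continuous_comp _ _ _ (fun y : R => k%:R * y) cos).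
  by apply: cvgM; [exact: cvg_cst|exact: cvg_id].
exact: continuous_cos.
Qed.

Lemma integral_cos k : integral0pi (fun x : R => cos (k%:R * x)) = (k == 0)%:R * pi.
Proof.
have [->|k0] := eqVneq k 0%N.
  rewrite mul1r /integral0pi.
  rewrite (@eq_Rintegral _ _ _ _ _ (cst 1)); last first.
    by move=> x _; rewrite mul0r cos0.
  rewrite (@integral_derivative R id (cst 1) 0 pi) ?subr0 ?pi_ge0//.
  exact: cst_continuous.
have kR : k%:R != 0 :> R by rewrite pnatr_eq0.
rewrite mul0r /integral0pi.
have dS (x : R) : is_derive x 1 (fun x => k%:R^-1 * sin (k%:R * x)) (cos (k%:R * x)).
  have := is_derive_dilation k%:R^-1 k%:R x (@is_derive_sin R).
  by rewrite mulVf// mul1r.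
rewrite (integral_derivative dS) ?pi_ge0//.
  by rewrite sin_nat_pi mulr0 mulr0 sin0 mulr0 subr0.
exact: continuous_cos_nat.
Qed.

Lemma integral_cos_cos (C : R) j l :
  integral0pi (fun x : R => C * (cos (j%:R * x) * cos (l%:R * x))) =
  C * (((j == l)%:R + (j + l == 0)%N%:R) / 2) * pi.
Proof.
wlog lj : j l / (l <= j)%N.
  move=> H; have [/H//|/ltnW lj] := leqP l j.
  rewrite (addnC j) (eq_sym j) -(H l j lj); apply: eq_Rintegral => x _.
  by rewrite [X in _ * X = _]mulrC.
have ic k : (@lebesgue_measure R).-integrable (dom R) (EFin \o (fun x => cos (k%:R * x))).
  exact: integrable_continuous_dom (@continuous_cos_nat k).
have mdom := @measurable_dom R.
have i1 k : (@lebesgue_measure R).-integrable (dom R)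
    (EFin \o (fun x => (C / 2) * cos (k%:R * x))).
  exact: (integrableZl (mu := @lebesgue_measure R) mdom (C / 2) (ic k)).
transitivity (\int[@lebesgue_measure R]_(x in dom R)
    (C / 2 * cos ((j + l)%:R * x) + C / 2 * cos ((j - l)%:R * x))).
  apply: eq_Rintegral => x _.
  by rewrite mul_cos_cos (cos_natB _ lj) natrD (mulrDl j%:R); ring.
rewrite (RintegralD (mu := @lebesgue_measure R) mdom (i1 _) (i1 _)).
rewrite (RintegralZl (mu := @lebesgue_measure R) (C / 2) mdom (ic (j + l)%N)).
rewrite (RintegralZl (mu := @lebesgue_measure R) (C / 2) mdom (ic (j - l)%N)).
have int_cos := integral_cos; rewrite /integral0pi in int_cos.
rewrite !int_cos subn_eq0.
have -> : (j <= l)%N = (j == l) by rewrite eqn_leq lj andbT.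
by ring.
Qed.

Lemma integral_sin_sin (C : R) j l :
  integral0pi (fun x : R => C * (sin (j%:R * x) * sin (l%:R * x))) =
  C * (((j == l)%:R - (j + l == 0)%N%:R) / 2) * pi.
Proof.
wlog lj : j l / (l <= j)%N.
  move=> H; have [/H//|/ltnW lj] := leqP l j.
  rewrite (addnC j) (eq_sym j) -(H l j lj); apply: eq_Rintegral => x _.
  by rewrite [X in _ * X = _]mulrC.
have ic k : (@lebesgue_measure R).-integrable (dom R) (EFin \o (fun x => cos (k%:R * x))).
  exact: integrable_continuous_dom (@continuous_cos_nat k).
have mdom := @measurable_dom R.
have i1 k : (@lebesgue_measure R).-integrable (dom R)
    (EFin \o (fun x => (C / 2) * cos (k%:R * x))).
  exact: (integrableZl (mu := @lebesgue_measure R) mdom (C / 2) (ic k)).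
transitivity (\int[@lebesgue_measure R]_(x in dom R)
    (C / 2 * cos ((j - l)%:R * x) - C / 2 * cos ((j + l)%:R * x))).
  apply: eq_Rintegral => x _.
  by rewrite mul_sin_sin (cos_natB _ lj) natrD (mulrDl j%:R); ring.
rewrite (RintegralB (mu := @lebesgue_measure R) mdom (i1 _) (i1 _)).
rewrite (RintegralZl (mu := @lebesgue_measure R) (C / 2) mdom (ic (j + l)%N)).
rewrite (RintegralZl (mu := @lebesgue_measure R) (C / 2) mdom (ic (j - l)%N)).
have int_cos := integral_cos; rewrite /integral0pi in int_cos.
rewrite !int_cos subn_eq0.
have -> : (j <= l)%N = (j == l) by rewrite eqn_leq lj andbT.
by ring.
Qed.

End Trigonometry.

(** * The cosine and sine bases *)

Section TrigonometricBases.
Context {R : realType}.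

Lemma sum_delta (F : nat -> R) (a N : nat) : (a < N)%N ->
  \sum_(l < N) (l == a :> nat)%:R * F l = F a.
Proof.
move=> aN; rewrite (bigD1 (Ordinal aN))//= eqxx mul1r big1 ?addr0// => l la.
by rewrite (_ : (nat_of_ord l == a) = false) ?mul0r//; exact: negbTE.
Qed.

Lemma sum_delta_le1 (a N : nat) : \sum_(l < N) (l == a :> nat)%:R <= 1 :> R.
Proof.
have [aN|Na] := ltnP a N.
  by have := sum_delta (fun=> 1) aN; under eq_bigr do rewrite mulr1; move=> ->.
by rewrite big1// => l _; rewrite ltn_eqF// (leq_trans (ltn_ord l)).
Qed.

Definition fourier_norm : R := Num.sqrt (2 / pi).

Lemma fourier_norm_ge0 : 0 <= fourier_norm.
Proof. exact: sqrtr_ge0. Qed.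

Lemma fourier_norm_sqr : fourier_norm * fourier_norm * pi = 2.
Proof.
rewrite -expr2 sqr_sqrtr ?divr_ge0 ?pi_ge0// divfK//.
by rewrite gt_eqF// pi_gt0.
Qed.

(** The constant function has a larger norm than the other cosines. *)
Definition cos_weight (l : nat) : R := if l is 0 then (Num.sqrt 2)^-1 else 1.

Lemma cos_weight_ge0 l : 0 <= cos_weight l.
Proof. by case: l => //=; rewrite invr_ge0 sqrtr_ge0. Qed.

Lemma cos_weight_sqr l : cos_weight l * cos_weight l = if l is 0 then 2^-1 else 1.
Proof. by case: l => [|l] /=; rewrite ?mulr1// -invfM -expr2 sqr_sqrtr. Qed.

Lemma cos_weight_le1 l : cos_weight l <= 1.
Proof.
case: l => //=; rewrite invf_le1 ?sqrtr_gt0// -[leLHS]sqrtr1.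
by rewrite ler_wsqrtr// ler1n.
Qed.

Definition cos_basis (l : nat) (x : R) : R := fourier_norm * cos_weight l * cos (l%:R * x).
Definition cos_basis' (l : nat) (x : R) : R :=
  fourier_norm * cos_weight l * l%:R * - sin (l%:R * x).
Definition sin_basis (l : nat) (x : R) : R := fourier_norm * sin (l.+1%:R * x).
Definition sin_basis' (l : nat) (x : R) : R :=
  fourier_norm * l.+1%:R * cos (l.+1%:R * x).

Lemma is_deriveN_sin (y : R) : is_derive y 1 (fun x => - sin x) (- cos y).
Proof. exact: is_deriveN. Qed.

Lemma continuousN_sin : continuous (fun x : R => - sin x).
Proof. by move=> x; apply: cvgN; exact: continuous_sin. Qed.

Lemma cos_basis_derive (l : nat) (x : R) : is_derive x 1 (cos_basis l) (cos_basis' l x).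
Proof. exact: (is_derive_dilation _ _ _ (@is_derive_cos R)). Qed.

Lemma cos_basis'_derive (l : nat) (x : R) : is_derive x 1 (cos_basis' l)
  (fourier_norm * cos_weight l * l%:R * l%:R * - cos (l%:R * x)).
Proof. exact: (is_derive_dilation _ _ _ is_deriveN_sin). Qed.

Lemma sin_basis_derive (l : nat) (x : R) : is_derive x 1 (sin_basis l) (sin_basis' l x).
Proof. exact: (is_derive_dilation _ _ _ (@is_derive_sin R)). Qed.

Lemma sin_basis'_derive (l : nat) (x : R) : is_derive x 1 (sin_basis' l)
  (fourier_norm * l.+1%:R * l.+1%:R * - sin (l.+1%:R * x)).
Proof. exact: (is_derive_dilation _ _ _ (@is_derive_cos R)). Qed.

Lemma continuous_cos_basis l : continuous (cos_basis l).
Proof. exact: continuous_dilation (@continuous_cos R). Qed.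
Lemma continuous_cos_basis' l : continuous (cos_basis' l).
Proof. exact: continuous_dilation continuousN_sin. Qed.
Lemma continuous_sin_basis l : continuous (sin_basis l).
Proof. exact: continuous_dilation (@continuous_sin R). Qed.
Lemma continuous_sin_basis' l : continuous (sin_basis' l).
Proof. exact: continuous_dilation (@continuous_cos R). Qed.

(** The weak form of [- f'' = d f]: the boundary terms vanish under the
    Neumann condition on [g = f'] as well as the Dirichlet condition on [v]. *)
Lemma weak_free_eigenfunction (f g G' v v' : R -> R) (d : R) :
  (forall x : R, is_derive x 1 g (G' x)) -> continuous G' -> continuous f ->
  (forall x, G' x = - (d * f x)) ->
  g pi * v pi = 0 -> g 0 * v 0 = 0 -> weak_derivative v v' ->
  integral0pi (fun x => g x * v' x) = d * integral0pi (fun x => f x * v x).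
Proof.
move=> dg cG' cf GE gpi g0 wv.
rewrite (weak_integration_by_parts dg cG' wv) gpi g0 subr0 sub0r.
have [mv [Cv vC]] := weak_derivative_cont_bounded wv.
have mdom := @measurable_dom R.
have ifv : (@lebesgue_measure R).-integrable (dom R) (EFin \o (fun x => f x * v x)).
  have ivf : (@lebesgue_measure R).-integrable (dom R) (EFin \o (fun x => v x * f x)).
    exact: integrable_bounded_mul mdom mv vC (integrable_continuous_dom cf).
  by apply: eq_integrable ivf => // x _ /=; rewrite mulrC.
rewrite /integral0pi -mulN1r.
rewrite -(RintegralZl (mu := @lebesgue_measure R) d mdom ifv).
have idfv : (@lebesgue_measure R).-integrable (dom R) (EFin \o (fun x => d * (f x * v x))).
  exact: (integrableZl (mu := @lebesgue_measure R) mdom d ifv).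
transitivity (-1 * \int[@lebesgue_measure R]_(x in dom R) (-1 * (d * (f x * v x)))).
  by congr (_ * _); apply: eq_Rintegral => x _; rewrite GE; ring.
by rewrite (RintegralZl (mu := @lebesgue_measure R) (-1) mdom idfv) mulrA mulrNN !mul1r.
Qed.

(** The coefficients of [cos (k x) * cos (j x)]; the frequency [j - k] is
    reflected to [k - j] when it is negative, which gives the last delta and,
    for sines, its sign. *)
Definition cos_mul_cos (k j l : nat) : R :=
  if k is 0 then (j == l)%:R else
  cos_weight j * cos_weight l / 2 *
    ((l == j + k)%N%:R + (j == l + k)%N%:R + (j + l == k)%N%:R).

(** Index [l] stands for the frequency [l + 1], hence the shift by 2 in the
    reflected term. *)
Definition cos_mul_sin (k j l : nat) : R :=
  if k is 0 then (j == l)%:R else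
  2^-1 * ((l == j + k)%N%:R + (j == l + k)%N%:R - (j + l + 2 == k)%N%:R).

Lemma cos_mul_cos_sym k j l : cos_mul_cos k j l = cos_mul_cos k l j.
Proof.
case: k => [|k] /=; first by rewrite eq_sym.
rewrite (addnC l j); ring.
Qed.

Lemma cos_mul_sin_sym k j l : cos_mul_sin k j l = cos_mul_sin k l j.
Proof.
case: k => [|k] /=; first by rewrite eq_sym.
rewrite (addnC l j); ring.
Qed.

Lemma delta_rows k j n (T : nat -> R) :
  (forall l, T l <= (l == j + k)%N%:R + (j == l + k)%N%:R + (l == k - j)%N%:R) ->
  \sum_(l < n) T l <= 3.
Proof.
move=> H; apply: le_trans (ler_sum _ (fun (l : 'I_n) _ => H l)) _.
rewrite !big_split/=.
have h2 : \sum_(l < n) (j == l + k)%N%:R <= 1 :> R.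
  apply: le_trans (sum_delta_le1 (j - k) n); apply: ler_sum => l _.
  by rewrite ler_nat; case: eqP => [->|//]; rewrite addnK eqxx.
have h1 := sum_delta_le1 (j + k) n; have h3 := sum_delta_le1 (k - j) n; lra.
Qed.

Lemma cos_mul_cos_rows k j n : \sum_(l < n) `|cos_mul_cos k j l| <= 3.
Proof.
apply: (@delta_rows k j n (fun l => `|cos_mul_cos k j l|)) => l; case: k => [|k] /=.
  by rewrite normr_nat -addrA addn0 eq_sym lerDl.
rewrite normrM ger0_norm; last first.
  by rewrite mulr_ge0 ?invr_ge0// mulr_ge0 ?cos_weight_ge0.
set T := (X in `|X|); have T0 : 0 <= T by rewrite !addr_ge0.
rewrite (ger0_norm T0); apply: (@le_trans _ _ T).
  rewrite ler_piMl// ler_pdivrMr// mul1r.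
  apply: le_trans (ler_pM _ _ (cos_weight_le1 j) (cos_weight_le1 l)) _ => //.
  - exact: cos_weight_ge0.
  - exact: cos_weight_ge0.
  - by rewrite mul1r ler1n.
rewrite /T lerD2l ler_nat; case: eqP => [<-|//]; rewrite addnC addnK eqxx//.
Qed.

Lemma cos_mul_sin_rows k j n : \sum_(l < n) `|cos_mul_sin k j l| <= 3.
Proof.
case: k => [|k].
  apply: (@delta_rows 0 j n (fun l => `|cos_mul_sin 0 j l|)) => l /=.
  by rewrite normr_nat -addrA addn0 eq_sym lerDl.
have h1 := sum_delta_le1 (j + k.+1) n; have h2 := sum_delta_le1 (j - k.+1) n.
have h3 := sum_delta_le1 (k.+1 - j - 2) n.
apply: (@le_trans _ _ (\sum_(l < n) ((nat_of_ord l == j + k.+1)%N%:R +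
    (nat_of_ord l == j - k.+1)%N%:R + (nat_of_ord l == k.+1 - j - 2)%N%:R))); last first.
  by rewrite !big_split/=; lra.
apply: ler_sum => l _ /=.
have e2 : (nat_of_bool (j == l + k.+1)%N)%:R <=
    (nat_of_bool (l == (j - k.+1)%N :> nat))%:R :> R.
  by rewrite ler_nat; case: eqP => [->|//]; rewrite addnK eqxx.
have e3 : (nat_of_bool (j + l + 2 == k.+1)%N)%:R <=
    (nat_of_bool (l == (k.+1 - j - 2)%N :> nat))%:R :> R.
  by rewrite ler_nat; lia.
rewrite normrM ger0_norm ?invr_ge0//.
rewrite ler_pdivrMl//.
apply: le_trans (ler_normB _ _) _; rewrite ger0_norm ?addr_ge0// normr_nat.
have := ler0n R (l == (j + k.+1)%N :> nat); have := ler0n R (l == (j - k.+1)%N :> nat).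
have := ler0n R (l == (k.+1 - j - 2)%N :> nat); lra.
Qed.

Lemma cos_mul_cos_far k j l : (j + l + 2 < k)%N -> cos_mul_cos k j l = 0.
Proof.
case: k => [//|k] h /=.
have -> : (l == j + k.+1)%N = false by lia.
have -> : (j == l + k.+1)%N = false by lia.
have -> : (j + l == k.+1)%N = false by lia.
by rewrite !addr0 mulr0.
Qed.

Lemma cos_mul_sin_far k j l : (j + l + 2 < k)%N -> cos_mul_sin k j l = 0.
Proof.
case: k => [//|k] h /=.
have -> : (l == j + k.+1)%N = false by lia.
have -> : (j == l + k.+1)%N = false by lia.
have -> : (j + l + 2 == k.+1)%N = false by lia.
by rewrite !addr0 subr0 mulr0.
Qed.

End TrigonometricBases.
Arguments fourier_norm {R}.

(** * The matrices of the two problems *)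

Section FourierGalerkin.
Context {R : realType}.

Lemma sum_delta_cond (P : nat -> bool) (d : bool) (F : nat -> R) (a N : nat) :
  (forall l, P l = d && (l == a)) -> (d -> (a < N)%N) ->
  \sum_(l < N) (P l)%:R * F l = d%:R * F a.
Proof.
move=> PE; case: d PE => PE aN; last first.
  by rewrite mul0r big1// => l _; rewrite PE mul0r.
rewrite mul1r -(sum_delta F (aN isT)); apply: eq_bigr => l _.
by rewrite PE.
Qed.

Lemma cos_mul_cosE k j N (x : R) : (j + k < N)%N ->
  \sum_(l < N) cos_mul_cos k j l * cos_basis l x = cos (k%:R * x) * cos_basis j x.
Proof.
case: k => [|k] jN /=.
  rewrite mul0r cos0 mul1r; rewrite addn0 in jN.
  rewrite (@sum_delta_cond (fun l => j == l) true (cos_basis^~ x) j) ?mul1r//.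
pose F l := cos_weight l * cos_weight l * cos (l%:R * x).
transitivity (fourier_norm * cos_weight j / 2 *
  (\sum_(l < N) (l == j + k.+1 :> nat)%N%:R * F l +
   \sum_(l < N) (j == l + k.+1)%N%:R * F l + \sum_(l < N) (j + l == k.+1)%N%:R * F l)).
  rewrite -!big_split/= mulr_sumr; apply: eq_bigr => l _.
  by rewrite /cos_basis /F; ring.
rewrite (@sum_delta_cond (fun l => l == j + k.+1)%N true F (j + k.+1))//.
rewrite (@sum_delta_cond (fun l => j == l + k.+1)%N (k.+1 <= j)%N F (j - k.+1)); [|lia..].
rewrite (@sum_delta_cond (fun l => j + l == k.+1)%N (j <= k.+1)%N F (k.+1 - j)); [|lia..].
rewrite {1}/F cos_weight_sqr addnS -addnS natrD mulrDl /cos_basis.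
rewrite [RHS]mulrCA mul_cos_cos.
rewrite (addrC (k.+1%:R * x)) -[true%:R]/(1 : R) mul1r.
suff h : (k.+1 <= j)%N%:R * F (j - k.+1)%N + (j <= k.+1)%N%:R * F (k.+1 - j)%N =
    cos (k.+1%:R * x - j%:R * x) by rewrite -addrA h; ring.
(* When [j] = k.+1 both deltas hit the constant function, each with half
   the weight. *)
rewrite /F !cos_weight_sqr; have [jk|jk|jk] := ltngtP j k.+1.
- rewrite mul0r add0r mul1r (cos_natB _ (ltnW jk)).
  by rewrite -(subnSK jk) mul1r.
- rewrite mul1r mul0r addr0 (cos_natB _ (ltnW jk)).
  by rewrite -(subnSK jk) mul1r -cosN opprB.
- by rewrite jk subnn !subrr mul0r cos0 -[true%:R]/(1 : R); field.
Qed.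

Lemma cos_mul_sinE k j N (x : R) : (j + k < N)%N ->
  \sum_(l < N) cos_mul_sin k j l * sin_basis l x = cos (k%:R * x) * sin_basis j x.
Proof.
case: k => [|k] jN /=.
  rewrite mul0r cos0 mul1r; rewrite addn0 in jN.
  rewrite (@sum_delta_cond (fun l => j == l) true (sin_basis^~ x) j) ?mul1r//.
pose F l := sin (l.+1%:R * x).
transitivity (fourier_norm / 2 *
  (\sum_(l < N) (l == j + k.+1 :> nat)%N%:R * F l +
   \sum_(l < N) (j == l + k.+1)%N%:R * F l - \sum_(l < N) (j + l + 2 == k.+1)%N%:R * F l)).
  rewrite -sumrN -!big_split/= mulr_sumr; apply: eq_bigr => l _.
  by rewrite /sin_basis /F; ring.
rewrite (@sum_delta_cond (fun l => l == j + k.+1)%N true F (j + k.+1))//.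
rewrite (@sum_delta_cond (fun l => j == l + k.+1)%N (k.+1 <= j)%N F (j - k.+1)); [|lia..].
rewrite (@sum_delta_cond (fun l => j + l + 2 == k.+1)%N (j + 2 <= k.+1)%N F
  (k.+1 - j - 2)); [|lia..].
rewrite {1}/F -addSn natrD mulrDl /sin_basis [RHS]mulrCA mul_cos_sin -[true%:R]/(1 : R) mul1r.
suff h : (k.+1 <= j)%N%:R * F (j - k.+1)%N - (j + 2 <= k.+1)%N%:R * F (k.+1 - j - 2)%N =
    sin (j.+1%:R * x - k.+1%:R * x) by rewrite -addrA h; ring.
rewrite /F; have [jk|jk|jk] := ltngtP j.+1 k.+1.
- have -> : (k.+1 <= j)%N = false by lia.
  have -> : (j + 2 <= k.+1)%N = true by lia.
  have -> : ((k.+1 - j - 2).+1 = k.+1 - j.+1)%N by lia.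
  by rewrite (natrB _ (ltnW jk)) mulrBl mul0r mul1r sub0r -sinN opprB.
- have -> : (k.+1 <= j)%N = true by lia.
  have -> : (j + 2 <= k.+1)%N = false by lia.
  have -> : ((j - k.+1).+1 = j.+1 - k.+1)%N by lia.
  by rewrite (natrB _ (ltnW jk)) mulrBl mul0r mul1r subr0.
- have -> : (k.+1 <= j)%N = false by lia.
  have -> : (j + 2 <= k.+1)%N = false by lia.
  by rewrite jk subrr sin0 !mul0r subr0.
Qed.

Variable q : R -> R.
Hypothesis hq : abs_cvg_cosine_expansion q.
Local Notation ec := (expansion_coef q).
Local Notation cos_matrix := (multiplication_matrix q cos_mul_cos).
Local Notation sin_matrix := (multiplication_matrix q cos_mul_sin).

Lemma cos_basis_bound l (x : R) : `|cos_basis l x| <= fourier_norm.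
Proof.
rewrite /cos_basis -mulrA normrM ger0_norm ?fourier_norm_ge0//.
rewrite ler_piMr ?fourier_norm_ge0// normrM mulr_ile1//; last exact: normr_cos_le1.
by rewrite ger0_norm ?cos_weight_ge0// cos_weight_le1.
Qed.

Lemma sin_basis_bound l (x : R) : `|sin_basis l x| <= fourier_norm.
Proof.
rewrite /sin_basis normrM ger0_norm ?fourier_norm_ge0//.
by rewrite ler_piMr ?fourier_norm_ge0// normr_sin_le1.
Qed.

Lemma nat_le_1sqr (l : nat) : l%:R <= 1 + l%:R ^+ 2 :> R.
Proof. by rewrite -natrX -(natrD _ 1) ler_nat; nia. Qed.

Lemma neumann_galerkin_basis : exists M,
  galerkin_basis q (H1 R) cos_basis cos_basis' (fun l => l%:R ^+ 2) cos_matrix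
    fourier_norm M.
Proof.
have [S HS] := expansion_coef_summable hq; exists (S * 3); split.
- by move=> l; exact: sqr_ge0.
- by move=> l; rewrite -!natrX natr1 -natrM ler_nat; nia.
- exact: multiplication_matrix_sym cos_mul_cos_sym.
- exact: multiplication_matrix_rows cos_mul_cos_rows cos_mul_cos_far _ HS.
- exact: potential_measurable hq.
- exact: potential_bounded hq.
- by move=> l; exact: measurable_continuous_dom (@continuous_cos_basis R l).
- by move=> l; exact: measurable_continuous_dom (@continuous_cos_basis' R l).
- by move=> l x _; exact: cos_basis_bound.
- move=> l x _; rewrite /cos_basis' -!mulrA normrM ger0_norm ?fourier_norm_ge0//.
  rewrite ler_wpM2l ?fourier_norm_ge0// normrM mulrC.
  rewrite [`|cos_weight l|]ger0_norm ?cos_weight_ge0//.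
  apply: le_trans (ler_pM _ _ (lexx _) (cos_weight_le1 l)) _ => //.
    exact: cos_weight_ge0.
  rewrite mulr1 normrM normrN normr_nat.
  apply: le_trans (nat_le_1sqr l); rewrite ler_piMr//.
  exact: normr_sin_le1.
- move=> l x /domP/andP[x0 _].
  rewrite (integral_derivative (cos_basis_derive l) (@continuous_cos_basis' R l) x0).
  by rewrite addrC subrK.
- move=> l v v' _ wv; apply: (weak_free_eigenfunction (cos_basis'_derive l)) wv.
  + move=> x; apply: cvgM; first exact: cvg_cst.
    by apply: cvgN; exact: continuous_cos_nat.
  + exact: continuous_cos_basis.
  + by move=> x; rewrite /cos_basis; ring.
  + by rewrite /cos_basis' sin_nat_pi oppr0 mulr0 mul0r.
  + by rewrite /cos_basis' mulr0 sin0 oppr0 mulr0 mul0r.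
- move=> j l.
  have -> : integral0pi (fun x : R => cos_basis j x * cos_basis l x) =
      integral0pi (fun x : R => (fourier_norm * cos_weight j * (fourier_norm * cos_weight l)) *
        (cos (j%:R * x) * cos (l%:R * x))).
    by apply: eq_Rintegral => x _; rewrite /cos_basis; ring.
  rewrite integral_cos_cos.
  have [<-|jl] := eqVneq j l; last first.
    have -> : (j + l == 0)%N = false by apply/negbTE; lia.
    by rewrite addr0 mul0r mulr0 mul0r.
  have w := @cos_weight_sqr R j; have := @fourier_norm_sqr R.
  set p := fourier_norm; set w' := cos_weight j in w *.
  move=> pp.
  have -> : p * w' * (p * w') * ((1 + (j + j == 0)%N%:R) / 2) * pi =
    (p * p * pi) * (w' * w') * ((1 + (j + j == 0)%N%:R) / 2) by ring.
  by rewrite pp w; case: (j) => [|j'] /=; field.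
- move=> j x xd; apply: (multiplication_matrix_cvg hq cos_mul_cos_rows cos_mul_cos_far) xd.
    by move=> k j' N x'; exact: cos_mul_cosE.
  by move=> l x' _; exact: cos_basis_bound.
- by [].
Qed.

Lemma dirichlet_galerkin_basis : exists M,
  galerkin_basis q (H10 R) sin_basis sin_basis' (fun l => l.+1%:R ^+ 2) sin_matrix
    fourier_norm M.
Proof.
have [S HS] := expansion_coef_summable hq; exists (S * 3); split.
- by move=> l; exact: sqr_ge0.
- by move=> l; rewrite -!natrX natr1 -natrM ler_nat; nia.
- exact: multiplication_matrix_sym cos_mul_sin_sym.
- exact: multiplication_matrix_rows cos_mul_sin_rows cos_mul_sin_far _ HS.
- exact: potential_measurable hq.
- exact: potential_bounded hq.
- by move=> l; exact: measurable_continuous_dom (@continuous_sin_basis R l).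
- by move=> l; exact: measurable_continuous_dom (@continuous_sin_basis' R l).
- by move=> l x _; exact: sin_basis_bound.
- move=> l x _; rewrite /sin_basis' -!mulrA normrM ger0_norm ?fourier_norm_ge0//.
  rewrite ler_wpM2l ?fourier_norm_ge0// normrM normr_nat.
  apply: le_trans (nat_le_1sqr l.+1); rewrite ler_piMr//.
  exact: normr_cos_le1.
- move=> l x /domP/andP[x0 _].
  rewrite (integral_derivative (sin_basis_derive l) (@continuous_sin_basis' R l) x0).
  by rewrite addrC subrK.
- move=> l v v' [_ v0 vpi] wv; apply: (weak_free_eigenfunction (sin_basis'_derive l)) wv.
  + exact: continuous_dilation continuousN_sin.
  + exact: continuous_sin_basis.
  + by move=> x; rewrite /sin_basis; ring.
  + by rewrite vpi mulr0.
  + by rewrite v0 mulr0.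
- move=> j l.
  have -> : integral0pi (fun x : R => sin_basis j x * sin_basis l x) =
      integral0pi (fun x : R => (fourier_norm * fourier_norm) *
        (sin (j.+1%:R * x) * sin (l.+1%:R * x))).
    by apply: eq_Rintegral => x _; rewrite /sin_basis; ring.
  rewrite integral_sin_sin addSn /= subr0 eqSS.
  have := @fourier_norm_sqr R; set p := fourier_norm => pp.
  have -> : p * p * ((j == l)%:R / 2) * pi = (p * p * pi) * ((j == l)%:R / 2) by ring.
  by rewrite pp; field.
- move=> j x xd; apply: (multiplication_matrix_cvg hq cos_mul_sin_rows cos_mul_sin_far) xd.
    by move=> k j' N x'; exact: cos_mul_sinE.
  by move=> l x' _; exact: sin_basis_bound.
- move=> u H1u u0; split=> //; apply: u0.
  + by apply/domP; rewrite lexx pi_ge0.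
  + by move=> l; rewrite /sin_basis mulr0 sin0 mulr0.
  + by apply/domP; rewrite lexx pi_ge0.
  + by move=> l; rewrite /sin_basis sin_nat_pi mulr0.
Qed.

Lemma multiplication_matrix_recl (b : nat -> nat -> nat -> R) j l :
  multiplication_matrix q b j l =
  ec 0 * b 0 j l + \sum_(k < (j + l).+2) ec k.+1 * b k.+1 j l.
Proof. by rewrite /multiplication_matrix addn3 big_ord_recl. Qed.

Lemma cos_matrix_diag0 : cos_matrix 0 0 = ec 0.
Proof.
rewrite multiplication_matrix_recl mulr1 big1 ?addr0// => k _.
by rewrite /= !addr0 !mulr0.
Qed.

Lemma cos_matrix_diag j : cos_matrix j.+1 j.+1 = ec 0 + ec (j.+1 * 2)%N / 2.
Proof.
rewrite multiplication_matrix_recl {1}/cos_mul_cos eqxx mulr1; congr (_ + _).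
transitivity (\sum_(k < (j.+1 + j.+1).+2) (j.+1 + j.+1 == k.+1)%N%:R * (ec k.+1 / 2)).
  apply: eq_bigr => k _; rewrite /cos_mul_cos /cos_weight.
  have -> : (j.+1 == j.+1 + k.+1)%N = false by lia.
  by rewrite !add0r !mulr1; ring.
rewrite (@sum_delta_cond (fun k => j.+1 + j.+1 == k.+1)%N true (fun k => ec k.+1 / 2)
  (j.+1 + j)) -?[true%:R]/(1 : R) ?mul1r; [|lia..].
by congr (expansion_coef q _ / 2); lia.
Qed.

Lemma sin_matrix_diag j : sin_matrix j j = ec 0 - ec (j.+1 * 2)%N / 2.
Proof.
rewrite multiplication_matrix_recl {1}/cos_mul_sin eqxx mulr1; congr (_ + _).
transitivity (\sum_(k < (j + j).+2) (j + j + 2 == k.+1)%N%:R * - (ec k.+1 / 2)).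
  apply: eq_bigr => k _; rewrite /cos_mul_sin.
  have -> : (j == j + k.+1)%N = false by lia.
  by rewrite !add0r; ring.
rewrite (@sum_delta_cond (fun k => j + j + 2 == k.+1)%N true (fun k => - (ec k.+1 / 2))
  (j + j).+1) -?[true%:R]/(1 : R) ?mul1r; [|lia..].
by congr (- (expansion_coef q _ / 2)); lia.
Qed.

Lemma cos_matrix_offdiag j p : (j < p)%N ->
  cos_matrix j p = cos_weight j * cos_weight p / 2 * (ec (p - j) + ec (j + p)).
Proof.
move=> jp; rewrite multiplication_matrix_recl {1}/cos_mul_cos (ltn_eqF jp) mulr0 add0r.
pose C : R := cos_weight j * cos_weight p / 2.
transitivity (C * (\sum_(k < (j + p).+2) (p == j + k.+1)%N%:R * ec k.+1 +
  \sum_(k < (j + p).+2) (j + p == k.+1)%N%:R * ec k.+1)).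
  rewrite -big_split/= mulr_sumr; apply: eq_bigr => k _; rewrite /cos_mul_cos.
  have -> : (j == p + k.+1)%N = false by lia.
  by rewrite /C addr0; ring.
rewrite (@sum_delta_cond (fun k => p == j + k.+1)%N true (fun k => ec k.+1)
  (p - j).-1); [|lia..].
rewrite (@sum_delta_cond (fun k => j + p == k.+1)%N true (fun k => ec k.+1)
  (j + p).-1); [|lia..].
rewrite -[true%:R]/(1 : R) !mul1r !prednK//; lia.
Qed.

End FourierGalerkin.

(** * The case of equality *)

Section TraceEquality.
Context {R : realType} (D : nat -> R) (B : nat -> nat -> R).
Hypothesis B_sym : forall j l, B j l = B l j.
Local Notation A := (schrodinger_coef D B).

Lemma schrodinger_coef_sym j l : A j l = A l j.
Proof.
rewrite /schrodinger_coef B_sym eq_sym.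
by case: eqVneq => [->|_]; rewrite ?mul0r.
Qed.

Lemma sum_two_deltas (N i p : nat) (c s : R) (F : nat -> R) :
  (i < N)%N -> (p < N)%N ->
  \sum_(l < N) (c * (l == i :> nat)%:R + s * (l == p :> nat)%:R) * F l =
  c * F i + s * F p.
Proof.
move=> iN pN; rewrite -(sum_delta F iN) -(sum_delta F pN) !mulr_sumr -big_split.
by apply: eq_bigr => l _ /=; ring.
Qed.

Lemma schrodinger_form_two (N i p : nat) (c s : R) : (i < N)%N -> (p < N)%N ->
  schrodinger_form D B N (fun l => c * (l == i)%:R + s * (l == p)%:R) =
  c ^+ 2 * A i i + 2 * c * s * A i p + s ^+ 2 * A p p.
Proof.
move=> iN pN; rewrite /schrodinger_form.
transitivity (\sum_(j < N) (c * (j == i :> nat)%:R + s * (j == p :> nat)%:R) *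
    (c * A j i + s * A j p)).
  apply: eq_bigr => j _; rewrite -(sum_two_deltas c s (A j) iN pN) mulr_sumr.
  by apply: eq_bigr => l _; ring.
rewrite (sum_two_deltas c s (fun j => c * A j i + s * A j p) iN pN).
by rewrite (schrodinger_coef_sym p i); ring.
Qed.

Lemma schrodinger_form_delta (N i : nat) : (i < N)%N ->
  schrodinger_form D B N (fun l => (l == i)%:R) = A i i.
Proof.
move=> iN; have := schrodinger_form_two 1 0 iN iN.
rewrite expr1n mul1r mulr0 mul0r addr0 expr2 !mul0r addr0 => <-.
by congr (schrodinger_form D B N _); apply/funext => l; rewrite mul1r mul0r addr0.
Qed.

End TraceEquality.

Section TraceBound.
Context {R : realType} (q : R -> R) (V : set (R -> R)) (f g : nat -> R -> R).
Context (D : nat -> R) (B : nat -> nat -> R) (c M : R) (nu : nat -> R).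
Hypothesis gb : galerkin_basis q V f g D B c M.
Hypothesis hnu : eigenvalue_sequence q V nu.
Local Notation A := (schrodinger_coef D B).

Lemma eigenvalue_sum_le_diag m : \sum_(i < m) nu i <= \sum_(i < m) A i i.
Proof.
apply: le_trans (eigenvalue_sum_le_trace (N := m) (phi := fun i l => (l == i)%:R) gb hnu _) _.
  move=> i k im km; rewrite (sum_delta (fun l => (l == k)%:R) im).
  by [].
by apply: ler_sum => i _; rewrite (schrodinger_form_delta D (gb_B_sym gb)).
Qed.

(** If the basis vectors already realise the minimal trace, rotating one of
    them towards a later one cannot decrease the trace; the first-order term of
    that rotation is the coupling between the two. *)
Lemma trace_equality_decouples m : \sum_(i < m) nu i = \sum_(i < m) A i i ->
  forall i p, (i < m)%N -> (m <= p)%N -> B i p = 0.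
Proof.
move=> eqA i p im mp.
have ip : (i == p) = false by apply/negbTE; lia.
have -> : B i p = A i p by rewrite /schrodinger_coef ip mul0r add0r.
apply: (@linear_coef_eq0 _ _ (A p p - A i i)) => t.
pose r := Num.sqrt (1 + t ^+ 2).
have t1 : 0 < 1 + t ^+ 2 by have := sqr_ge0 t; lra.
have r2 : r ^+ 2 = 1 + t ^+ 2 by rewrite sqr_sqrtr// ltW.
have r0 : r != 0 by rewrite gt_eqF// sqrtr_gt0.
pose a := r^-1; pose s := t * a.
have a2 : a ^+ 2 * (1 + t ^+ 2) = 1 by rewrite -r2 /a exprVn mulVf// expf_neq0.
have as1 : a * a + s * s = 1 by rewrite /s -a2; ring.
pose phi k l : R := if k == i then a * (l == i)%:R + s * (l == p)%:R else (l == k)%:R.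
have iN : (i < p.+1)%N by lia.
have phio k k' : (k < m)%N -> (k' < m)%N ->
    \sum_(l < p.+1) phi k l * phi k' l = (k == k')%:R.
  move=> km k'm; rewrite {1}/phi; case: (eqVneq k i) => [->|ki].
    rewrite (sum_two_deltas a s (phi k') iN (ltnSn p)) /phi.
    case: (eqVneq k' i) => [_|k'i].
      by rewrite !eqxx [p == i]eq_sym ip !mulr1 !mulr0 addr0 add0r as1.
    by rewrite (_ : (p == k') = false) ?mulr0 ?addr0//; apply/negbTE; lia.
  have kN : (k < p.+1)%N by lia.
  rewrite (sum_delta (phi k') kN) /phi; case: (eqVneq k' i) => [k'E|//]; rewrite k'E.
  rewrite (negbTE ki) (_ : (k == p) = false) ?mulr0 ?addr0//.
  by apply/negbTE; lia.
have := eigenvalue_sum_le_trace gb hnu phio.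
rewrite eqA (bigD1 (Ordinal im))//= [leRHS](bigD1 (Ordinal im))//=.
rewrite [X in _ <= _ + X](eq_bigr (fun k : 'I_m => A k k)); last first.
  move=> k ki; rewrite -(schrodinger_form_delta D (gb_B_sym gb) (N := p.+1)); last first.
    by apply: leq_trans (ltn_ord k) _; lia.
  congr (schrodinger_form D B _ _); apply/funext => l; rewrite /phi.
  by rewrite (_ : (nat_of_ord k == i) = false)//; exact: negbTE.
rewrite lerD2r.
have -> : phi i = fun l => a * (l == i)%:R + s * (l == p)%:R.
  by apply/funext => l; rewrite /phi eqxx.
rewrite (schrodinger_form_two D (gb_B_sym gb) a s iN (ltnSn p)) -subr_ge0.
have -> : a ^+ 2 * A i i + 2 * a * s * A i p + s ^+ 2 * A p p - A i i =
    a ^+ 2 * (2 * t * A i p + t ^+ 2 * (A p p - A i i)) +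
    (a ^+ 2 * (1 + t ^+ 2) - 1) * A i i by rewrite /s; ring.
rewrite a2 subrr mul0r addr0.
by rewrite pmulr_rge0// exprn_even_gt0//= invr_neq0.
Qed.

End TraceBound.

(** * Sums of Dirichlet and Neumann eigenvalues *)

Theorem theorem3p4 (R : realType) (q : R -> R) (lambda mu : nat -> R)
    (hq : abs_cvg_cosine_expansion q)
    (hlambda : dirichlet_eigenvalues q lambda)
    (hmu : neumann_eigenvalues q mu)
    (n : nat) (hn : (1 <= n)%N) :
  let total : R :=
    \sum_(1 <= k < n.+1) ((lambda k + mu k) / 2 - k%:R ^+ 2 - mean q)
    + 2^-1 * (mu 0%N - mean q) in
  total <= 0 /\
  (total = 0 -> exists c : R, forall x : R, x \in dom R -> q x = c).
Proof.
move=> total; have [MN gN] := neumann_galerkin_basis hq.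
have [MD gD] := dirichlet_galerkin_basis hq.
have boundD := eigenvalue_sum_le_diag gD hlambda n.
have boundN := eigenvalue_sum_le_diag gN hmu n.+1.
set ec := expansion_coef q.
have diagD i : schrodinger_coef (fun l => l.+1%:R ^+ 2)
    (multiplication_matrix q cos_mul_sin) i i = i.+1%:R ^+ 2 + (ec 0 - ec (i.+1 * 2)%N / 2).
  by rewrite /schrodinger_coef eqxx mul1r sin_matrix_diag.
have diagN i : schrodinger_coef (fun l => l%:R ^+ 2)
    (multiplication_matrix q cos_mul_cos) i.+1 i.+1 = i.+1%:R ^+ 2 + (ec 0 + ec (i.+1 * 2)%N / 2).
  by rewrite /schrodinger_coef eqxx mul1r cos_matrix_diag.
have diagN0 : schrodinger_coef (fun l => l%:R ^+ 2)
    (multiplication_matrix q cos_mul_cos) 0 0 = ec 0.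
  by rewrite /schrodinger_coef eqxx mul1r expr0n add0r cos_matrix_diag0.
set traceD := \sum_(i < n) schrodinger_coef _ _ i i in boundD.
set traceN := \sum_(i < n.+1) schrodinger_coef _ _ i i in boundN.
(* The second harmonics [ec (2 i)] enter the two diagonals with opposite
   signs and cancel in the average. *)
have totalE : total = 2^-1 * (\sum_(i < n) lambda i.+1 - traceD) +
    2^-1 * (\sum_(i < n.+1) mu i - traceN).
  rewrite /total (mean_expansion_coef q) -/ec big_add1 /= big_mkord.
  rewrite /traceN !big_ord_recl /= diagN0 /traceD.
  have -> : \sum_(i < n) ((lambda i.+1 + mu i.+1) / 2 - i.+1%:R ^+ 2 - ec 0) =
    2^-1 * (\sum_(i < n) lambda i.+1 - \sum_(i < n) schrodinger_coef (fun l => l.+1%:R ^+ 2)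
      (multiplication_matrix q cos_mul_sin) i i) +
    2^-1 * (\sum_(i < n) mu i.+1 - \sum_(i < n) schrodinger_coef (fun l => l%:R ^+ 2)
      (multiplication_matrix q cos_mul_cos) i.+1 i.+1).
    rewrite -!sumrB !mulr_sumr -big_split; apply: eq_bigr => i _ /=.
    by rewrite -[cos_coef q 0 / 2]/(ec 0) diagD diagN; field.
  by rewrite /bump /= -[cos_coef q 0 / 2]/(ec 0); ring.
split; first by rewrite totalE; lra.
move=> total0.
(* Both brackets in [totalE] are nonpositive, so both vanish. *)
have eqN : \sum_(i < n.+1) mu i = traceN by move: total0; rewrite totalE; lra.
have dec := trace_equality_decouples gN hmu eqN.
(* The constant function decouples from every frequency above [n]. *)
have high p : (n < p)%N -> ec p = 0.
  move=> np; have := dec 0%N p (ltn0Sn n) np; rewrite cos_matrix_offdiag; last first.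
    by rewrite (leq_ltn_trans _ np).
  rewrite subn0 add0n -/ec => /eqP; rewrite mulf_eq0 => /orP[|/eqP]; last by lra.
  have w0 l : @cos_weight R l != 0.
    by case: l => [|l] /=; rewrite ?oner_neq0// invr_neq0// gt_eqF// sqrtr_gt0.
  by rewrite !mulf_eq0 !(negbTE (w0 _)) invr_eq0 pnatr_eq0.
(* The coupling of frequencies [n] and [n + p] involves the coefficients [p]
   and [2 n + p], and the latter vanishes by [high]. *)
have all_freq p : (0 < p)%N -> ec p = 0.
  move=> p0; have := dec n (n + p)%N (ltnSn n); rewrite cos_matrix_offdiag; last by lia.
  rewrite addKn -/ec (high (n + (n + p))%N) ?addr0; last by lia.
  have w1 l : (0 < l)%N -> @cos_weight R l = 1 by case: l.
  rewrite !w1; [|lia..] => h.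
  have /h : (n < n + p)%N by lia.
  lra.
exists (ec 0) => x /set_mem xd.
have c := expansion_cvg hq xd.
apply/esym/(cvg_unique _ _ c); first exact: Rhausdorff.
apply: cvg_near_cst; apply: filterS (nbhs_infty_gt 0) => N N0.
rewrite (bigD1 (Ordinal N0))//= mul0r cos0 mulr1 big1 ?addr0// => -[k kN] /= k0.
by rewrite -/(ec k) all_freq ?mul0r// lt0n.
Qed.
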